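(* Let $X$ be a circularly ordered compact space. Then the topological group $H_+(X)$ of all c-order preserving bijections $X\to X$, equipped with the compact open topology, is Rosenthal representable. For example, this holds for $H_+(\mathbb{T})$, where $\mathbb{T}$ is the circle with its usual circular order.
   Context: A circular order on a set $X$ is a relation $R\subset X^3$ (write $[a,b,c]$ for $(a,b,c)\in R$) such that: (Cyclicity) $[a,b,c]\Rightarrow[b,c,a]$; (Asymmetry) $[a,b,c]\Rightarrow (a,c,b)\notin R$; (Transitivity) $[a,b,c]$ and $[a,c,d]$ imply $[a,b,d]$; (Totality) if $a,b,c$ are distinct then $[a,b,c]$ or $[a,c,b]$. For $a\ne b$ put $(a,b)_R=\{x:[a,x,b]\}$ and $[a,b]_R=(a,b)_R\cup\{a,b\}$; put $[a,a]_R=\{a\}$. The interval topology $\tau_R$ has the sets $(a,b)_R$ as a base (if $|X|\le 2$ take the discrete topology). A circularly ordered compact space is a compact space whose topology is $\tau_R$ for a given circular order $R$. A map $f:X_1\to X_2$ between circularly ordered sets is c-order preserving (COP) if (1) $[a,b,c]$ and $f(a),f(b),f(c)$ distinct imply $[f(a),f(b),f(c)]$; and (2) $f(a)=f(c)$ implies $f$ is constant on one of $[a,c]_R$, $[c,a]_R$. $H_+(X)$ is the group of all COP bijections $X\to X$ (these are homeomorphisms). The usual circular order on $\mathbb{T}=\mathbb{R}/\mathbb{Z}$, identified as a set with $[0,1)$, is: $[x,y,z]$ iff $(y-x)(z-y)(z-x)>0$. A Banach space is Rosenthal if it contains no isomorphic copy of $\ell_1$. A topological group $G$ is Rosenthal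 representable if there are a Rosenthal Banach space $V$ and a topological group embedding (an injective homomorphism that is a homeomorphism onto its image) of $G$ into the group $\mathrm{Iso}(V)$ of linear onto isometries of $V$ with the strong operator topology. *)

(* Defs.v *)
From HB Require Import structures.
From mathcomp Require Import all_boot all_order all_algebra.
From mathcomp Require Import all_classical all_reals all_analysis.
From mathcomp Require Import lra.

Set Implicit Arguments.
Unset Strict Implicit.
Unset Printing Implicit Defensive.

Import Order.TTheory GRing.Theory Num.Theory.
Import numFieldNormedType.Exports.

Local Open Scope classical_set_scope.
Local Open Scope ring_scope.

HB.mixin Record isCircularlyOrdered T := {
  (* [cord a b c] is the relation [a, b, c] *)
  cord : T -> T -> T -> Prop;
  cord_cyclic : forall a b c, cord a b c -> cord b c a;
  cord_asym : forall a b c, cord a b c -> ~ cord a c b;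
  cord_trans : forall a b c d, cord a b c -> cord a c d -> cord a b d;
  cord_total : forall a b c, a <> b -> b <> c -> a <> c ->
    cord a b c \/ cord a c b
}.

#[short(type="circType")]
HB.structure Definition CircularlyOrdered :=
  {T of isCircularlyOrdered T & Choice T}.

Arguments cord_cyclic {s a b c}.
Arguments cord_asym {s a b c}.
Arguments cord_trans {s a b c d}.
Arguments cord_total {s a b c}.

Section circular_intervals.
Context {T : circType}.
Implicit Types (a b c d e f x y : T) (U : set T).

Definition oarc a b : set T := [set x | cord a x b].

(* [oarc a a] is empty, so that [carc a a] is [set a]; see [carc_id] *)
Definition carc a b : set T := oarc a b `|` [set a; b].

(* The sets with base the [oarc a b]; everything is open when [T] has at most
   two points. *)
Definition arc_open U :=
  (forall a b c, [\/ a = b, b = c | a = c]) \/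
  (forall x, U x -> exists a b, [/\ a <> b, oarc a b x & oarc a b `<=` U]).

Lemma cord_neq a b c : cord a b c -> [/\ a <> b, b <> c & a <> c].
Proof.
have aab (x y : T) : ~ cord x x y.
  by move=> h; exact: (cord_asym h (cord_cyclic h)).
move=> h; split=> e.
- by rewrite e in h; exact: (aab b c).
- by rewrite e in h; apply: (aab c a); exact: cord_cyclic.
- by rewrite e in h; apply: (aab c b); do 2 apply: cord_cyclic.
Qed.

Lemma oarc_id a : oarc a a = set0.
Proof. by apply/seteqP; split=> // x /cord_neq[]. Qed.

Lemma carc_id a : carc a a = [set a].
Proof. by rewrite /carc oarc_id set0U setUid. Qed.

Lemma arc_openT : arc_open setT.
Proof.
rewrite /arc_open.
have [h|h] := pselect (forall a b c : T, [\/ a = b, b = c | a = c]).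
  by left.
right=> x _; apply: contrapT => nx; apply: h => a b c.
have two p q : p <> q -> p <> x -> x <> q -> False.
  move=> pq px xq; apply: nx.
  by have [h|h] := cord_total px xq pq; [exists p, q|exists q, p; split=> //;
     [exact: nesym|apply: cord_cyclic; exact: h]].
have [ab|ab] := pselect (a = b); first exact: Or31.
have [bc|bc] := pselect (b = c); first exact: Or32.
have [ac|ac] := pselect (a = c); first exact: Or33.
exfalso.
have [ax|ax] := pselect (a = x).
  by apply: (two b c) => //; [rewrite -ax; exact: nesym|rewrite -ax].
have [bx|bx] := pselect (b = x).
  by apply: (two a c) => //; rewrite -bx.
by apply: (two a b) => // /esym.
Qed.

(* in the linear order obtained by cutting at [x], f <= b < a <= e *)
Lemma sub_oarc x a b e f : cord x b a -> cord x f a ->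
  e = a \/ cord x a e -> f = b \/ cord x f b -> oarc e f `<=` oarc a b.
Proof.
rewrite /oarc => xba xfa ae fb y /= eyf.
have ayf : cord a y f.
  case: ae => [<-//|xae].
  have fae : cord f a e.
    apply: cord_cyclic; apply: cord_cyclic.
    exact: (cord_trans (cord_cyclic xae)
      (cord_cyclic (cord_cyclic xfa))).
  apply: cord_cyclic; apply: (cord_trans fae).
  by apply: cord_cyclic; apply: cord_cyclic.
case: fb => [<-//|xfb].
apply: (cord_trans ayf); apply: cord_cyclic.
exact: (cord_trans (cord_cyclic xba) (cord_cyclic (cord_cyclic xfb))).
Qed.

Lemma oarcI x a b c d : oarc a b x -> oarc c d x ->
  exists e f, [/\ e <> f, oarc e f x & oarc e f `<=` oarc a b `&` oarc c d].
Proof.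
move=> axb cxd; have xba := cord_cyclic axb; have xdc := cord_cyclic cxd.
have [xb ba xa] := cord_neq xba; have [xd dc xc] := cord_neq xdc.
have [e [ea ec e2]] : exists e, [/\ e = a \/ cord x a e, e = c \/ cord x c e
    & e = a \/ e = c].
  have [->|ac] := pselect (a = c); first by exists c; split; left.
  have [xac|xca] := cord_total xa ac xc.
    by exists c; split; [right|left|right].
  by exists a; split; [left|right|left].
have [f [fb fd]] : exists f, (f = b \/ cord x f b) /\ (f = d \/ cord x f d).
  have [->|bd] := pselect (b = d); first by exists d; split; left.
  have [xbd|xdb] := cord_total xb bd xd.
    by exists b; split; [left|right].
  by exists d; split; [right|left].
have xfa : cord x f a.
  by case: fb => [->//|xfb]; exact: cord_trans xfb xba.
have xfc : cord x f c.
  by case: fd => [->//|xfd]; exact: cord_trans xfd xdc.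
have xfe : cord x f e by case: e2 => ->.
have [_ fe _] := cord_neq xfe.
exists e, f; split; first exact: nesym.
  by apply: cord_cyclic; apply: cord_cyclic.
move=> y efy; split; first exact: (sub_oarc xba xfa ea fb efy).
exact: (sub_oarc xdc xfc ec fd efy).
Qed.

Lemma arc_openI : setI_closed arc_open.
Proof.
move=> A B [h _|hA]; first by left.
case=> [h|hB]; first by left.
right=> x [/hA[a [b [_ xab abA]]] /hB[c [d [_ xcd cdB]]]].
have [e [f [ef xef sub]]] := oarcI xab xcd.
by exists e, f; split=> // y /sub[/abA ? /cdB].
Qed.

Lemma arc_open_bigU (I : Type) (f : I -> set T) :
  (forall i, arc_open (f i)) -> arc_open (\bigcup_i f i).
Proof.
move=> fo; rewrite /arc_open.
have [h|h] := pselect (forall a b c : T, [\/ a = b, b = c | a = c]).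
  by left.
right=> x [i _ fix_]; have [//|/(_ x fix_)[a [b [ab xab sub]]]] := fo i.
by exists a, b; split=> // y /sub fiy; exists i.
Qed.

End circular_intervals.

HB.mixin Record CircularlyOrdered_isTopological (T : Type)
    of Topological T & CircularlyOrdered T := {
  open_arcE : (open : set_system T) = arc_open
}.

#[short(type="circTopologicalType")]
HB.structure Definition CircTopological :=
  {T of Topological T & CircularlyOrdered T
      & CircularlyOrdered_isTopological T}.

(* [T] endowed with the interval topology of its circular order *)
Definition circ_topology (T : Type) : Type := T.

Section circ_topology.
Variable T : circType.
HB.instance Definition _ := CircularlyOrdered.on (circ_topology T).
HB.instance Definition _ := @isOpenTopological.Build (circ_topology T)
  (@arc_open T) (@arc_openT T) (@arc_openI T)
  (@arc_open_bigU T).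
HB.instance Definition _ := CircularlyOrdered_isTopological.Build
  (circ_topology T) erefl.
End circ_topology.

Definition constant_on {T U : Type} (A : set T) (f : T -> U) :=
  forall x y, A x -> A y -> f x = f y.

Definition cop {T U : circType} (f : T -> U) :=
  (forall a b c, cord a b c -> f a <> f b -> f b <> f c -> f a <> f c ->
     cord (f a) (f b) (f c)) /\
  (forall a c, f a = f c ->
     constant_on (carc a c) f \/ constant_on (carc c a) f).

Record Hplus (T : circType) := MkHplus {
  Hplus_fun :> T -> T;
  Hplus_cop : cop Hplus_fun;
  Hplus_bij : bijective Hplus_fun
}.

Section Hplus_group.
Variable T : circType.
Implicit Types f g h : Hplus T.

HB.instance Definition _ := gen_eqMixin (Hplus T).
HB.instance Definition _ := gen_choiceMixin (Hplus T).

Lemma Hplus_eq f g : f =1 g -> f = g.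
Proof.
case: f g => [f cf bf] [g cg bg] /= /funext fg.
by subst g; rewrite (Prop_irrelevance cf cg) (Prop_irrelevance bf bg).
Qed.

Lemma cop_inj (f : T -> T) : injective f ->
  (forall a b c, cord a b c -> cord (f a) (f b) (f c)) -> cop f.
Proof.
move=> fI fc; split=> [a b c abc _ _ _|a c /fI ->]; first exact: fc.
by left; rewrite carc_id => x y -> ->.
Qed.

Lemma Hplus_cord f a b c : cord a b c -> cord (f a) (f b) (f c).
Proof.
move=> abc; have [ab bc ac] := cord_neq abc.
have fI := bij_inj (Hplus_bij f).
by apply: (Hplus_cop f).1 => // /fI.
Qed.

Lemma Hplus_inv_subproof f : exists g : Hplus T, cancel f g /\ cancel g f.
Proof.
have [g fK gK] := Hplus_bij f.
have gI := can_inj gK.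
have gn (p q : T) : p <> q -> g p <> g q by move=> pq /gI.
have gc : cop g.
  apply: (cop_inj gI) => a b c abc; have [ab bc ac] := cord_neq abc.
  case: (cord_total (gn _ _ ab) (gn _ _ bc) (gn _ _ ac)) => // acb.
  by have := Hplus_cord f acb; rewrite !gK => acb'; case: (cord_asym abc).
by exists (MkHplus gc (Bijective gK fK)).
Qed.

Definition Hplus_one : Hplus T :=
  MkHplus (@cop_inj id (fun _ _ => id) (fun _ _ _ => id))
    (Bijective (fun=> erefl) (fun=> erefl)).

Definition Hplus_mul f g : Hplus T :=
  MkHplus (@cop_inj (f \o g)
      (inj_comp (bij_inj (Hplus_bij f)) (bij_inj (Hplus_bij g)))
      (fun a b c abc => Hplus_cord f (Hplus_cord g abc)))
    (bij_comp (Hplus_bij f) (Hplus_bij g)).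

Definition Hplus_inv f : Hplus T := projT1 (cid (Hplus_inv_subproof f)).

Lemma Hplus_invK f : cancel f (Hplus_inv f).
Proof. by rewrite /Hplus_inv; case: cid => g [fK gK]. Qed.

Lemma Hplus_Kinv f : cancel (Hplus_inv f) f.
Proof. by rewrite /Hplus_inv; case: cid => g [fK gK]. Qed.

Fact Hplus_mulA : associative Hplus_mul.
Proof. by move=> f g h; apply: Hplus_eq. Qed.
Fact Hplus_mul1 : left_id Hplus_one Hplus_mul.
Proof. by move=> f; apply: Hplus_eq. Qed.
Fact Hplus_1mul : right_id Hplus_one Hplus_mul.
Proof. by move=> f; apply: Hplus_eq. Qed.
Fact Hplus_mulV : left_inverse Hplus_one Hplus_inv Hplus_mul.
Proof. by move=> f; apply: Hplus_eq => x /=; rewrite Hplus_invK. Qed.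
Fact Hplus_Vmul : right_inverse Hplus_one Hplus_inv Hplus_mul.
Proof. by move=> f; apply: Hplus_eq => x /=; rewrite Hplus_Kinv. Qed.

HB.instance Definition _ := isGroup.Build (Hplus T)
  Hplus_mulA Hplus_mul1 Hplus_1mul Hplus_mulV Hplus_Vmul.

End Hplus_group.

(* Only the join of the two structures: continuity of the group operations is
   not part of it. In [rosenthal_representable] it is automatic, being inherited
   from [linear_isometry V] along the embedding. *)
#[short(type="preTopologicalGroupType")]
HB.structure Definition PreTopologicalGroup :=
  {G of Group G & Topological G}.

HB.instance Definition _ (T : circTopologicalType) :=
  Topological.copy (Hplus T)
    (@initial_topology (Hplus T) {compact-open, T -> T} (@Hplus_fun T)).

Record linear_isometry (R : realType) (V : normedModType R) := MkIsometry {
  isometry_fun :> V -> V;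
  isometry_linear : linear isometry_fun;
  isometry_norm : forall x, `|isometry_fun x| = `|x|;
  isometry_onto : set_surj setT setT isometry_fun
}.

Section linear_isometry_group.
Variables (R : realType) (V : normedModType R).
Implicit Types f g h : linear_isometry V.

HB.instance Definition _ := gen_eqMixin (linear_isometry V).
HB.instance Definition _ := gen_choiceMixin (linear_isometry V).

Lemma isometry_eq f g : f =1 g -> f = g.
Proof.
case: f g => [f lf nf sf] [g lg ng sg] /= /funext fg.
subst g; rewrite (Prop_irrelevance lf lg) (Prop_irrelevance nf ng).
by rewrite (Prop_irrelevance sf sg).
Qed.

Lemma isometry_inj f : injective f.
Proof.
move=> x y fxy; apply/eqP; rewrite -subr_eq0 -normr_eq0 -(isometry_norm f).
have -> : x - y = (-1) *: y + x by rewrite scaleN1r addrC.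
by rewrite (isometry_linear f (-1)) fxy scaleN1r addNr normr0.
Qed.

Lemma isometry_inv_subproof f :
  exists g : linear_isometry V, cancel f g /\ cancel g f.
Proof.
have /choice[g gK] : forall y, exists x, f x = y.
  by move=> y; have [x _ <-] : range f y := isometry_onto f I; exists x.
have fK : cancel f g by move=> x; apply: (@isometry_inj f); rewrite gK.
have gl : linear g.
  move=> a x y; apply: (@isometry_inj f).
  by rewrite (isometry_linear f) !gK.
have gn x : `|g x| = `|x| by rewrite -(isometry_norm f) gK.
have gs : set_surj setT setT g by move=> x _; exists (f x).
by exists (MkIsometry gl gn gs).
Qed.

Definition isometry_one : linear_isometry V :=
  @MkIsometry R V id (fun _ _ _ => erefl) (fun=> erefl)
    (fun x _ => ex_intro2 _ _ x I erefl).

Lemma isometry_mul_linear f g : linear (f \o g).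
Proof. by move=> a x y /=; rewrite !isometry_linear. Qed.

Lemma isometry_mul_norm f g x : `|(f \o g) x| = `|x|.
Proof. by rewrite /= !isometry_norm. Qed.

Lemma isometry_mul_onto f g : set_surj setT setT (f \o g).
Proof.
move=> z _; have [y _ <-] : range f z := isometry_onto f I.
by have [x _ <-] : range g y := isometry_onto g I; exists x.
Qed.

Definition isometry_mul f g : linear_isometry V :=
  MkIsometry (isometry_mul_linear f g) (isometry_mul_norm f g)
    (isometry_mul_onto f g).

Definition isometry_inv f : linear_isometry V :=
  projT1 (cid (isometry_inv_subproof f)).

Fact isometry_mulA : associative isometry_mul.
Proof. by move=> f g h; apply: isometry_eq. Qed.
Fact isometry_mul1 : left_id isometry_one isometry_mul.
Proof. by move=> f; apply: isometry_eq. Qed.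
Fact isometry_1mul : right_id isometry_one isometry_mul.
Proof. by move=> f; apply: isometry_eq. Qed.
Fact isometry_mulV : left_inverse isometry_one isometry_inv isometry_mul.
Proof.
move=> f; apply: isometry_eq => x; rewrite /isometry_inv.
by case: cid => g [fK gK] /=.
Qed.
Fact isometry_Vmul : right_inverse isometry_one isometry_inv isometry_mul.
Proof.
move=> f; apply: isometry_eq => x; rewrite /isometry_inv.
by case: cid => g [fK gK] /=.
Qed.

HB.instance Definition _ := isGroup.Build (linear_isometry V)
  isometry_mulA isometry_mul1 isometry_1mul isometry_mulV isometry_Vmul.

(* strong operator topology *)
HB.instance Definition _ := Topological.copy (linear_isometry V)
  (@initial_topology (linear_isometry V) {ptws V -> V} (@isometry_fun R V)).

End linear_isometry_group.

Section ell1.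
Variable R : realType.

Definition summable_seq : {pred R^nat} :=
  [pred x : R^nat | `[< cvgn (series (fun n => `|x n|)) >]].

Lemma summable_seqP (x : R^nat) :
  reflect (cvgn (series (fun n => `|x n|))) (x \in summable_seq).
Proof. exact: asboolP. Qed.

Fact summable_seq_submod : submod_closed summable_seq.
Proof.
split.
  apply/summable_seqP.
  have -> : series (fun n => `|(0 : R^nat) n|) = fun=> 0.
    apply/funext => n; rewrite seriesEnat/= big1// => i _.
    by rewrite normr0.
  exact: is_cvg_cst.
move=> a x y /summable_seqP xs /summable_seqP ys; apply/summable_seqP.
apply: (@series_le_cvg _ _ (fun n => `|a| * `|x n| + `|y n|)).
- by move=> n.
- by move=> n; rewrite addr_ge0// mulr_ge0.
- by move=> n; rewrite /= (le_trans (ler_normD _ _))// normrM.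
- exact: (is_cvg_seriesD (@is_cvg_seriesZ _ _ `|a| xs) ys).
Qed.

HB.instance Definition _ :=
  GRing.isSubmodClosed.Build R R^nat summable_seq summable_seq_submod.

Definition ell1 : Type := {x : R^nat | x \in summable_seq}.

HB.instance Definition _ := SubChoice.on ell1.
HB.instance Definition _ := [SubChoice_isSubLmodule of ell1 by <:].

Definition ell1_norm (x : ell1) : R := limn (series (fun n => `|val x n|)).

Let ell1P (x : ell1) : cvgn (series (fun n => `|val x n|)).
Proof. exact/summable_seqP/(valP x). Qed.

Fact ell1_normD (x y : ell1) :
  ell1_norm (x + y) <= ell1_norm x + ell1_norm y.
Proof.
rewrite /ell1_norm -limD//; apply: ler_lim; [exact: ell1P|exact: is_cvgD|].
apply: nearW => n.
have -> : (series (fun k => `|val x k|) + series (fun k => `|val y k|)) n =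
    \sum_(0 <= k < n) (`|val x k| + `|val y k|).
  by rewrite big_split.
by apply: ler_sum => i _; exact: ler_normD.
Qed.

Fact ell1_normZ (a : R) (x : ell1) : ell1_norm (a *: x) = `|a| * ell1_norm x.
Proof.
rewrite /ell1_norm.
have -> : series (fun n => `|val (a *: x) n|) =
    `|a| *: series (fun n => `|val x n|).
  apply/funext => n.
  transitivity (`|a| * \sum_(0 <= k < n) `|val x k|) => //.
  by rewrite mulr_sumr; apply: eq_bigr => i _; exact: normrM.
exact: (limZl_tmp _ (@ell1P x)).
Qed.

Fact ell1_norm_eq0 (x : ell1) : ell1_norm x = 0 -> x = 0.
Proof.
move=> x0; apply/val_inj/funext => n.
apply/eqP; change (val x n == 0 :> R); rewrite -normr_le0 -x0.
have nd : nondecreasing_seq (series (fun n => `|val x n|)).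
  by apply/nondecreasing_seqP => k; rewrite !seriesEnat/= big_nat_recr//= lerDl.
apply: le_trans (nondecreasing_cvgn_le nd (@ell1P x) n.+1).
by rewrite seriesEnat/= big_nat_recr//= lerDr sumr_ge0.
Qed.

HB.instance Definition _ := Lmodule_isNormed.Build R ell1
  ell1_normD ell1_normZ ell1_norm_eq0.

End ell1.

(* homeomorphism onto the image *)
Definition topological_embedding {T U : topologicalType} (f : T -> U) :=
  [/\ injective f, continuous f &
      forall A : set T, open A ->
        exists2 B : set U, open B & f @` A = B `&` range f].

Definition rosenthal (R : realType) (V : completeNormedModType R) :=
  ~ exists f : {linear ell1 R -> V}, topological_embedding f.

Definition rosenthal_representable (R : realType)
    (G : preTopologicalGroupType) :=
  exists2 V : completeNormedModType R, rosenthal V &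
    exists f : {multiplicative G -> linear_isometry V},
      topological_embedding f.

Definition circle (R : realType) : Type := {x : R | 0 <= x < 1}.

Section circle.
Variable R : realType.

HB.instance Definition _ := SubChoice.on (circle R).

Definition circle_cord (x y z : circle R) : Prop :=
  0 < (val y - val x) * (val z - val y) * (val z - val x).

Let prod3_gt0 (a b c : R) :
  [\/ a < b < c, b < c < a | c < a < b] -> 0 < (b - a) * (c - b) * (c - a).
Proof.
have pos (u v w : R) : u < v -> v < w -> 0 < (v - u) * (w - v) * (w - u).
  by move=> uv vw; rewrite !mulr_gt0 ?subr_gt0// (lt_trans uv).
by case=> /andP[h1 h2]; have := pos _ _ _ h1 h2; lra.
Qed.

Lemma circle_cordP (x y z : circle R) : circle_cord x y z <->
  [\/ val x < val y < val z, val y < val z < val x | val z < val x < val y].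
Proof.
rewrite /circle_cord; move: (val x) (val y) (val z) => a b c.
split; last exact: prod3_gt0.
move=> D; have nD : ~ 0 < (c - a) * (b - c) * (b - a) by lra.
have [ab|ba|ab] := ltgtP a b; last by move: D; rewrite ab subrr !mul0r ltxx.
- have [bc|cb|bc] := ltgtP b c; first by apply: Or31.
  + have [ac|ca|ac] := ltgtP a c; last by move: D; rewrite ac subrr mulr0 ltxx.
      by exfalso; apply/nD/prod3_gt0/Or31/andP.
    by apply/Or33/andP.
  + by move: D; rewrite bc subrr mulr0 mul0r ltxx.
- have [bc|cb|bc] := ltgtP b c;
    last by move: D; rewrite bc subrr mulr0 mul0r ltxx.
  + have [ac|ca|ac] := ltgtP a c; last by move: D; rewrite ac subrr mulr0 ltxx.
      by exfalso; apply/nD/prod3_gt0/Or33/andP.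
    by apply/Or32/andP.
  + by exfalso; apply/nD/prod3_gt0/Or32/andP.
Qed.

Fact circle_cyclic x y z : circle_cord x y z -> circle_cord y z x.
Proof.
by move=> /circle_cordP h; apply/circle_cordP; case: h => h;
  [apply: Or33|apply: Or31|apply: Or32].
Qed.

Fact circle_asym x y z : circle_cord x y z -> ~ circle_cord x z y.
Proof. rewrite /circle_cord; nra. Qed.

Fact circle_trans x y z t :
  circle_cord x y z -> circle_cord x z t -> circle_cord x y t.
Proof.
move=> /circle_cordP h /circle_cordP h'; apply/circle_cordP.
move: (val x) (val y) (val z) (val t) h h' => a b c d.
case=> /andP[h1 h2] [] /andP[h3 h4]; first [ exfalso; lra |
  by apply: Or31; lra | by apply: Or32; lra | by apply: Or33; lra].
Qed.

Fact circle_total x y z : x <> y -> y <> z -> x <> z ->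
  circle_cord x y z \/ circle_cord x z y.
Proof.
move=> xy yz xz.
have ne (p q : circle R) : p <> q -> val p != val q.
  by move=> pq; apply/eqP => /val_inj.
move: (ne _ _ xy) (ne _ _ yz) (ne _ _ xz) => {}xy {}yz {}xz.
have : (val y - val x) * (val z - val y) * (val z - val x) != 0.
  by rewrite !mulf_neq0// subr_eq0 eq_sym.
rewrite neq_lt /circle_cord => /orP[h|h]; [right; lra|by left].
Qed.

HB.instance Definition _ := isCircularlyOrdered.Build (circle R)
  circle_cyclic circle_asym circle_trans circle_total.

End circle.

(* Main.v *)
Require Import Defs.
From mathcomp Require Import all_boot all_order all_algebra.
From mathcomp Require Import all_classical all_reals all_analysis.
From mathcomp Require Import lra ring.
From HB Require Import structures.

Set Implicit Arguments.
Unset Strict Implicit.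
Unset Printing Implicit Defensive.

Import Order.TTheory GRing.Theory Num.Theory.
Import numFieldNormedType.Exports.

Local Open Scope classical_set_scope.
Local Open Scope ring_scope.

(** Let X be a compact circularly ordered space and G its group of c-order
preserving bijections. For a function f on X and a finite chain x0, ..., xn
running once around X in the circular order, put

  energy f = f(x0)^2 + sum_i (f(x_(i+1)) - f(x_i))^2,

and let the norm of f be the square root of the supremum of these energies.
This is a James-type norm, of quadratic variation. A c-order preserving
bijection permutes the chains, so G acts by isometries through composition.
The Banach space V is the set of functions that are approximable in this norm
by continuous functions of bounded (linear) variation.

V contains no copy of l1 for two reasons. First, an energy bound allows few
large jumps: N functions of energy at most C^2 have, along any chain, at most
N C^2 / d^2 steps at which one of them jumps by more than d, so up to d they
take simultaneously only O(N) vectors of values ([finite_net]). A vector of N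
bounded values is balanced to o(N) by most choices of signs, and O(N) vectors
can be balanced at once ([balanced_signs]); hence every bounded sequence in V
has averages with signs that are uniformly small on X ([small_sign_average]).
Secondly, a bounded element that is uniformly small on X is nearly orthogonal
to a given f in V: up to a small error, the cross terms of the energy are at
most a multiple of its supremum times the linear variation of an approximation
of f ([norm_near_orthogonal]).
Alternating the two, one gets from a bounded sequence, for every j, a linear
combination with coefficients of absolute sum j and norm O(sqrt j), against the
lower estimate of l1 ([no_ell1_sequence]).

The representation is strongly continuous because the energy of a function is
at most r^2 + 2 r M when r bounds it and M bounds its linear variation: if f is
continuous of bounded variation and h is close to g in the compact-open
topology, then f o h - f o g is uniformly small while its variation stays
bounded ([orbit_continuous]).

The representation is an embedding because V separates points from closed sets
([variation_space_bump]). A Urysohn function u at c, for which there is no bound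
on the variation, is replaced by the function whose value at y is the larger of
the infima of u over the two arcs that join c to y. It increases up to c and
decreases after it, so that its variation is bounded, and it is still
continuous. The norm dominates the supremum, so strong convergence in G gives
uniform convergence of the composed bumps, hence compact-open convergence
([action_open]). *)

(** * The circular order cut at a point *)

Lemma path_insert {T : eqType} (r : rel T) x s y : transitive r ->
    r x y -> {in s, forall z, r z y || r y z} -> path r x s ->
  exists s1 s2, s = s1 ++ s2 /\ path r x (s1 ++ y :: s2).
Proof.
move=> rT; elim: s x => [|z s IH] x xy cmp /=.
  by exists [::], [::]; rewrite /= xy.
move=> /andP[xz zs]; have /orP[zy|yz] := cmp z (mem_head _ _).
  have cmp' : {in s, forall w, r w y || r y w}.
    by move=> w ws; apply: cmp; rewrite inE ws orbT.
  have [s1 [s2 [-> p]]] := IH z zy cmp' zs.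
  by exists (z :: s1), s2; rewrite /= xz.
by exists [::], (z :: s); rewrite /= xy yz.
Qed.

(** Both new steps are far wherever the point goes, since it is far from every
point of the path. *)
Lemma path_insert_far {T : eqType} (r : rel T) x s1 s2 y : symmetric r ->
  {in x :: s1 ++ s2, forall z, r z y} -> path r x (s1 ++ s2) ->
  path r x (s1 ++ y :: s2).
Proof.
move=> rS far; rewrite !cat_path /= => /andP[-> p] /=; apply/andP; split.
  apply: far; have := mem_last x s1; rewrite !inE => /orP[->//|h].
  by rewrite mem_cat h orbT.
case: s2 p far => //= z s2 /andP[_ ->] far; rewrite andbT rS.
by apply: far; rewrite inE mem_cat mem_head !orbT.
Qed.

Section cut_order.
Context {T : circType}.
Implicit Types (a b c x y z : T) (s : seq T).

(** Cutting the circle at [c] opens it into a strict linear order with least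
element [c]. *)
Definition cutlt c a b : bool := `[< (a = c /\ b <> c) \/ cord c a b >].

Lemma cutltP c a b : reflect ((a = c /\ b <> c) \/ cord c a b) (cutlt c a b).
Proof. exact: asboolP. Qed.

Lemma cutlt_neq_base c a b : cutlt c a b -> b <> c.
Proof. by move=> /cutltP[[]//|/cord_neq[_ _ /nesym]]. Qed.

Lemma cutlt_cord c a b : a <> c -> cutlt c a b -> cord c a b.
Proof. by move=> ac /cutltP[[]|]. Qed.

Lemma cord_cutlt c a b : cord c a b -> cutlt c a b.
Proof. by move=> h; apply/cutltP; right. Qed.

Lemma cutlt_base c b : b <> c -> cutlt c c b.
Proof. by move=> bc; apply/cutltP; left. Qed.

Lemma cutlt_trans c : transitive (cutlt c).
Proof.
move=> b a d /cutltP ab bd; have dc := cutlt_neq_base bd.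
apply/cutltP; case: ab => [[-> bc]|cab]; first by left.
right; apply: (cord_trans cab).
by apply: cutlt_cord bd; have [/nesym _ _ /nesym] := cord_neq cab.
Qed.

Lemma cutlt_asym c a b : cutlt c a b -> ~~ cutlt c b a.
Proof.
move=> ab; apply/negP => ba.
have := cutlt_cord (cutlt_neq_base ab) ba.
have := cutlt_cord (cutlt_neq_base ba) ab.
by move=> /cord_asym.
Qed.

Lemma cutlt_irr c a : cutlt c a a = false.
Proof. by apply/negbTE/negP => aa; move: (cutlt_asym aa); rewrite aa. Qed.

Lemma cutlt_total c a b : a <> b -> cutlt c a b || cutlt c b a.
Proof.
move=> ab; apply/orP.
have [ac|ac] := pselect (a = c).
  by left; rewrite ac; apply: cutlt_base; rewrite -ac; exact: nesym.
have [bc|bc] := pselect (b = c).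
  by right; rewrite bc; exact: cutlt_base.
have [h|h] := cord_total (nesym ac) ab (nesym bc).
  by left; exact: cord_cutlt.
by right; exact: cord_cutlt.
Qed.

(** Moving the cut from [c] to [d] exchanges the initial segment below [d] with
the rest and keeps the order inside each of the two pieces. *)
Lemma cutlt_rebase c d a b :
  cutlt c a b -> cutlt c a d = cutlt c b d -> cutlt d a b.
Proof.
move=> ab; have bc := cutlt_neq_base ab.
have [->|dc] := pselect (d = c) => //.
case bd: (cutlt c b d) => ad.
  have cbd := cutlt_cord bc bd.
  case/cutltP: ab => [[-> _]|cab].
    exact/cord_cutlt/cord_cyclic/cord_cyclic.
  apply/cord_cutlt/cord_cyclic.
  exact: cord_trans (cord_cyclic cbd) (cord_cyclic (cord_cyclic cab)).
have bDd : b <> d.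
  by move=> e; move: ad; rewrite -e ab.
have [->|aDd] := pselect (a = d); first exact: cutlt_base.
have da : cutlt c d a by have := cutlt_total c aDd; rewrite ad.
have cab : cord c a b by apply: cutlt_cord ab => ac; move: (cutlt_neq_base da).
have cda := cutlt_cord dc da.
apply/cord_cutlt/cord_cyclic/cord_cyclic.
exact: cord_trans (cord_cyclic cab) (cord_cyclic (cord_cyclic cda)).
Qed.

(** The sequence [x :: s] runs through distinct points around the circle,
starting at [x]; the base point of the cut order is the first point, so that
the notion is invariant under c-order preserving bijections. *)
Definition cyclic_chain x s := path (cutlt x) x s.

(** A chain of maximal length among those whose consecutive points are far
apart is a net: a point far from all of its points could be inserted. *)
Lemma finite_net (R : realType) (far : rel T) (B : R) : 0 <= B ->
    symmetric far -> irreflexive far ->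
    (forall x s, cyclic_chain x s -> path far x s -> (size s)%:R <= B) ->
  exists2 Y : seq T, (size Y)%:R <= B + 1 &
    forall y, exists2 x, x \in Y & ~~ far x y.
Proof.
move=> B0 farS farI bnd.
have [[x0 _]|nT] := pselect (exists x : T, True); last first.
  exists [::]; first by rewrite addr_ge0.
  by move=> y; case: nT; exists y.
pose P n := `[< exists x s, [/\ cyclic_chain x s, path far x s & size s = n] >].
have exP : exists n, P n by exists 0%N; apply/asboolP; exists x0, [::].
have ubP n : P n -> (n <= Num.Def.archi_bound B)%N.
  move=> /asboolP[x [s [cs ps <-]]]; rewrite -(ler_nat R).
  by apply: le_trans (bnd _ _ cs ps) _; apply/ltW/archi_boundP.
case: (ex_maxnP exP ubP) => n /asboolP[x [s [cs ps sn]]] nmax.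
exists (x :: s); first by rewrite /= -natr1 lerD2r; exact: bnd ps.
move=> y; apply: contrapT => nfar.
have {}nfar : {in x :: s, forall z, far z y}.
  by move=> z zs; apply: contrapT => /negP h; apply: nfar; exists z.
have neq z : z \in x :: s -> z <> y.
  by move=> /nfar fz zy; rewrite zy farI in fz.
have [s1 [s2 [se c]]] : exists s1 s2, s = s1 ++ s2 /\
    cyclic_chain x (s1 ++ y :: s2).
  apply: path_insert cs; first exact: cutlt_trans.
    by apply: cutlt_base; apply/nesym/neq/mem_head.
  by move=> z zs; apply/cutlt_total/neq; rewrite inE zs orbT.
rewrite {}se in ps nfar sn neq.
have : P n.+1.
  apply/asboolP; exists x, (s1 ++ y :: s2); split => //.
    exact: path_insert_far.
  by rewrite size_cat /= addnS -size_cat sn.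
by move=> /nmax; rewrite ltnn.
Qed.

End cut_order.

(** * Sums along a path *)

Section path_sum.
Context {R : realType} {T : Type}.
Implicit Types (w : T -> T -> R) (x : T) (s : seq T).

Fixpoint path_sum w x s : R :=
  if s is y :: s' then w x y + path_sum w y s' else 0.

Lemma le_path_sum w w' x s : (forall a b, w a b <= w' a b) ->
  path_sum w x s <= path_sum w' x s.
Proof. by move=> h; elim: s x => //= y s IH x; exact: lerD. Qed.

Lemma path_sum_ge0 w x s : (forall a b, 0 <= w a b) -> 0 <= path_sum w x s.
Proof. by move=> h; elim: s x => //= y s IH x; exact: addr_ge0. Qed.

Lemma path_sumD w w' x s :
  path_sum (fun a b => w a b + w' a b) x s = path_sum w x s + path_sum w' x s.
Proof. by elim: s x => [|y s IH] x /=; [rewrite addr0|rewrite IH addrACA]. Qed.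

Lemma path_sumZ (k : R) w x s :
  path_sum (fun a b => k * w a b) x s = k * path_sum w x s.
Proof. by elim: s x => [|y s IH] x /=; [rewrite mulr0|rewrite IH mulrDr]. Qed.

Lemma path_sum_sum n (w : nat -> T -> T -> R) x s :
  path_sum (fun a b => \sum_(k < n) w k a b) x s =
  \sum_(k < n) path_sum (w k) x s.
Proof.
elim: s x => [|y s IH] x /=; first by rewrite big1.
by rewrite IH big_split.
Qed.

Lemma path_sum_size (w : T -> T -> R) (d : R) x s :
    path (fun a b => d <= w a b) x s ->
  d * (size s)%:R <= path_sum w x s.
Proof.
elim: s x => [|y s IH] x /=; first by rewrite mulr0.
by move=> /andP[xy /IH]; rewrite -natr1 mulrDr mulr1 addrC; exact: lerD.
Qed.

End path_sum.
Arguments path_sum_size {R T w d x s}.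

Lemma path_sum_map {R : realType} {T U : Type} (g : T -> U)
    (w : U -> U -> R) x s :
  path_sum w (g x) (map g s) = path_sum (fun a b => w (g a) (g b)) x s.
Proof. by elim: s x => //= y s IH x; rewrite IH. Qed.

(** * Energy and variation along cyclic chains *)

Section energy_estimates.
Context {R : realType} {T : circType}.
Implicit Types (f g : T -> R) (x : T) (s : seq T).

(** The square of the value at the first point makes the supremum of the
energies the square of a norm, instead of a seminorm vanishing on constants. *)
Definition energy f x s : R :=
  f x ^+ 2 + path_sum (fun a b => (f b - f a) ^+ 2) x s.

Lemma energy_ge0 f x s : 0 <= energy f x s.
Proof.
by rewrite addr_ge0 ?sqr_ge0// path_sum_ge0// => a b; exact: sqr_ge0.
Qed.

Definition chain_variation f x s : R := path_sum (fun a b => `|f b - f a|) x s.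

Lemma energyZ (k : R) f x s :
  energy (fun y => k * f y) x s = k ^+ 2 * energy f x s.
Proof.
rewrite /energy mulrDr exprMn -path_sumZ; congr (_ + path_sum _ x s).
by apply/funext => a; apply/funext => b; rewrite -mulrBr exprMn.
Qed.

Lemma le_energyD f g (p q : R) x s :
    (forall u v : R, (u + v) ^+ 2 <= p * u ^+ 2 + q * v ^+ 2) ->
  energy (fun y => f y + g y) x s <= p * energy f x s + q * energy g x s.
Proof.
move=> pq; rewrite /energy !mulrDr addrACA; apply: lerD; first exact: pq.
rewrite -!path_sumZ -path_sumD; apply: le_path_sum => a b.
by rewrite opprD addrACA.
Qed.

Lemma energyD2 f g x s :
  energy (fun y => f y + g y) x s <= 2 * energy f x s + 2 * energy g x s.
Proof. by apply: le_energyD => u v; have := sqr_ge0 (u - v); nra. Qed.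

(** Minkowski's inequality, from the convexity of the square in the form
(u + v)^2 <= (1 + B/A) u^2 + (1 + A/B) v^2, with equality when u : v = A : B. *)
Lemma energy_triangle f g (A B : R) x s : 0 < A -> 0 < B ->
    energy f x s <= A ^+ 2 -> energy g x s <= B ^+ 2 ->
  energy (fun y => f y + g y) x s <= (A + B) ^+ 2.
Proof.
move=> A0 B0 fA gB.
apply: (@le_trans _ _
    ((1 + B / A) * energy f x s + (1 + A / B) * energy g x s)).
  apply: le_energyD => u v.
  have -> : (1 + B / A) * u ^+ 2 + (1 + A / B) * v ^+ 2 =
      (u + v) ^+ 2 + (B * u - A * v) ^+ 2 / (A * B).
    by field; rewrite !gt_eqF.
  by rewrite lerDl divr_ge0 ?sqr_ge0 ?mulr_ge0 ?ltW.
have -> : (A + B) ^+ 2 = (1 + B / A) * A ^+ 2 + (1 + A / B) * B ^+ 2.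
  by field; rewrite !gt_eqF.
by apply: lerD; apply: ler_wpM2l; rewrite // addr_ge0// divr_ge0// ltW.
Qed.

(** Each squared increment is at most [2 * r] times the increment: functions of
bounded variation that are uniformly small are small in energy. *)
Lemma energy_small f (r M : R) x s : 0 <= r -> (forall y, `|f y| <= r) ->
  chain_variation f x s <= M -> energy f x s <= r ^+ 2 + 2 * r * M.
Proof.
move=> r0 fr fM; apply: lerD.
  by rewrite -(real_normK (num_real _)) lerXn2r ?nnegrE.
apply: le_trans (ler_wpM2l _ fM); last by rewrite mulr_ge0.
rewrite -path_sumZ; apply: le_path_sum => a b.
rewrite -(real_normK (num_real _)) expr2; apply: ler_wpM2r => //.
by rewrite (le_trans (ler_normB _ _))// mulr2n mulrDl !mul1r lerD.
Qed.

(** The cross terms 2 df dg are split as 2 df0 dg + 2 (df - df0) dg. The first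
sum is controlled by the supremum of [g] and the variation of [f0]; the second
is absorbed by the energies of [f - f0] and [g], with weight [t]. *)
Lemma energy_near_orthogonal f f0 g (r t : R) x s : 0 <= r -> 0 < t ->
    (forall y, `|g y| <= r) ->
  energy (fun y => f y + g y) x s <=
  energy f x s + (1 + t) * energy g x s +
  (t^-1 * energy (fun y => f y - f0 y) x s +
   2 * r * (`|f0 x| + 2 * chain_variation f0 x s)).
Proof.
move=> r0 t0 gr.
have cross (u u0 v w : R) : `|v| <= w ->
    (u + v) ^+ 2 <=
    u ^+ 2 + (1 + t) * v ^+ 2 + (t^-1 * (u - u0) ^+ 2 + 2 * w * `|u0|).
  move=> vw.
  have uv : v * u0 <= w * `|u0|.
    by rewrite (le_trans (ler_norm _))// normrM ler_wpM2r.
  have -> : (u + v) ^+ 2 = u ^+ 2 + (1 + t) * v ^+ 2 + (t^-1 * (u - u0) ^+ 2 +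
      2 * (v * u0)) - t^-1 * (u - u0 - t * v) ^+ 2 by field; rewrite gt_eqF.
  rewrite lerBlDr; apply: ler_wpDr.
    by rewrite mulr_ge0 ?sqr_ge0// invr_ge0 ltW.
  by rewrite !lerD2l -mulrA ler_wpM2l.
rewrite /energy.
have -> : f x ^+ 2 + path_sum (fun a b => (f b - f a) ^+ 2) x s +
    (1 + t) * (g x ^+ 2 + path_sum (fun a b => (g b - g a) ^+ 2) x s) +
    (t^-1 * ((f x - f0 x) ^+ 2 +
      path_sum (fun a b => (f b - f0 b - (f a - f0 a)) ^+ 2) x s) +
    2 * r * (`|f0 x| + 2 * chain_variation f0 x s)) =
    (f x ^+ 2 + (1 + t) * g x ^+ 2 +
      (t^-1 * (f x - f0 x) ^+ 2 + 2 * r * `|f0 x|)) +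
    (path_sum (fun a b => (f b - f a) ^+ 2) x s +
     (1 + t) * path_sum (fun a b => (g b - g a) ^+ 2) x s +
     (t^-1 * path_sum (fun a b => (f b - f0 b - (f a - f0 a)) ^+ 2) x s +
      2 * (2 * r) * chain_variation f0 x s)).
  by ring.
apply: lerD; first exact: cross.
rewrite -!path_sumZ -!path_sumD; apply: le_path_sum => a b.
have -> : f b - f0 b - (f a - f0 a) = f b - f a - (f0 b - f0 a) by ring.
rewrite opprD addrACA; apply: cross.
by rewrite (le_trans (ler_normB _ _))// mulr2n mulrDl !mul1r lerD.
Qed.

Lemma energy_comp f (g : T -> T) x s :
  energy (fun y => f (g y)) x s = energy f (g x) (map g s).
Proof. by rewrite /energy path_sum_map. Qed.

Lemma chain_variation_comp f (g : T -> T) x s :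
  chain_variation (fun y => f (g y)) x s = chain_variation f (g x) (map g s).
Proof. by rewrite /chain_variation path_sum_map. Qed.

Definition chain_bounded f :=
  exists M, forall x s, cyclic_chain x s -> chain_variation f x s <= M.

Lemma chain_boundedD f g : chain_bounded f -> chain_bounded g ->
  chain_bounded (fun y => f y + g y).
Proof.
move=> [M fM] [N gN]; exists (M + N) => x s cs.
apply: le_trans (lerD (fM _ _ cs) (gN _ _ cs)).
rewrite -path_sumD; apply: le_path_sum => a b.
by rewrite opprD addrACA ler_normD.
Qed.

Lemma chain_bounded_mulr (k : R) f : chain_bounded f ->
  chain_bounded (fun y => k * f y).
Proof.
move=> [M fM]; exists (`|k| * M) => x s cs.
apply: le_trans (ler_wpM2l _ (fM _ _ cs)) => //.
rewrite -path_sumZ; apply: le_path_sum => a b.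
by rewrite -mulrBr normrM.
Qed.

(** Any point other than a fixed [x0] ends a chain of length two from [x0], so
one constant bounds both the values and the variations. *)
Lemma chain_bounded_sup f : chain_bounded f ->
  exists2 M, 0 <= M & (forall x, `|f x| <= M) /\
    forall x s, cyclic_chain x s -> chain_variation f x s <= M.
Proof.
move=> [M fM].
have [[x0 _]|nT] := pselect (exists x : T, True); last first.
  by exists 0 => //; split => [x|x]; case: nT; exists x.
have M0 : 0 <= M by exact: fM x0 [::] isT.
exists (`|f x0| + M); first exact: addr_ge0.
split => [x|x s cs]; last by apply: ler_wpDl => //; exact: fM.
have -> : f x = f x0 + (f x - f x0) by rewrite addrC subrK.
apply: (le_trans (ler_normD _ _)); apply: lerD => //.
have [->|xx0] := pselect (x = x0); first by rewrite subrr normr0.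
have := fM x0 [:: x].
rewrite /cyclic_chain /chain_variation /= addr0 andbT; apply.
exact: cutlt_base.
Qed.

End energy_estimates.

(** * Sign averages with small supremum *)

Section signs.
Context {R : realType} {T : Type}.

(** Derandomized fourth moment bound for sums with random signs. The potential
(S^2 + c)^2, averaged over the two signs of a new term v with |v| <= C, is at
most (S^2 + c + 3 C^2)^2, so one of the signs does not exceed that average;
adding 3 C^2 to [c] at each step makes the induction go through. For [c = 0] it
bounds the sum of S^4 by 9 C^4 n^2 times the number of points. *)
Lemma balanced_signs (f : nat -> T -> R) (C : R) (Y : seq T) n c : 0 <= c ->
    (forall k y, `|f k y| <= C) ->
  exists2 e : nat -> R, (forall k, `|e k| = 1) &
    \sum_(y <- Y) ((\sum_(k < n) e k * f k y) ^+ 2 + c) ^+ 2 <=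
    (size Y)%:R * (3 * C ^+ 2 * n%:R + c) ^+ 2.
Proof.
move=> + fC; elim: n c => [|n IH] c c0.
  exists (fun=> 1) => [k|]; first exact: normr1.
  under eq_bigr do rewrite big_ord0 expr0n add0r.
  by rewrite mulr0 add0r big_const_seq count_predT iter_addr_0 mulr_natl.
have c3 : 0 <= c + 3 * C ^+ 2.
  by apply: addr_ge0 => //; apply: mulr_ge0 => //; exact: sqr_ge0.
have [e e1 eY] := IH _ c3.
pose S y := \sum_(k < n) e k * f k y.
pose e' (t : R) k := if k == n then t else e k.
have S' t y : \sum_(k < n.+1) e' t k * f k y = S y + t * f n y.
  rewrite big_ord_recr /= /e' eqxx; congr (_ + _).
  by apply: eq_bigr => k _; rewrite ltn_eqF.
pose Q t := \sum_(y <- Y) ((\sum_(k < n.+1) e' t k * f k y) ^+ 2 + c) ^+ 2.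
have Q2 : Q 1 + Q (- 1) <= 2 * ((size Y)%:R * (3 * C ^+ 2 * n.+1%:R + c) ^+ 2).
  have -> : 3 * C ^+ 2 * n.+1%:R + c = 3 * C ^+ 2 * n%:R + (c + 3 * C ^+ 2).
    by rewrite -natr1; ring.
  apply: le_trans (ler_wpM2l _ eY) => //.
  rewrite /Q -big_split mulr_sumr /=; apply: ler_sum => y _.
  rewrite !S' -/(S y); move: (S y) (f n y) (fC n y) => u v vC.
  have C2 : v ^+ 2 <= C ^+ 2.
    by rewrite -(real_normK (num_real v)) lerXn2r ?nnegrE ?(le_trans _ vC).
  have v0 : 0 <= v ^+ 2 by exact: sqr_ge0.
  have u0 : 0 <= u ^+ 2 by exact: sqr_ge0.
  move: (C ^+ 2) C2 => D C2.
  have -> : ((u + 1 * v) ^+ 2 + c) ^+ 2 + ((u + - 1 * v) ^+ 2 + c) ^+ 2 =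
    2 * ((u ^+ 2 + c + v ^+ 2) ^+ 2 + 4 * u ^+ 2 * v ^+ 2) by ring.
  move: (u ^+ 2) (v ^+ 2) u0 v0 C2 => p q p0 q0 qD.
  nra.
have [Q1|Q1] := leP (Q 1) ((size Y)%:R * (3 * C ^+ 2 * n.+1%:R + c) ^+ 2).
  exists (e' 1) => // k; rewrite /e'; case: ifP => // _; exact: normr1.
exists (e' (-1)); last by rewrite -/(Q (- 1)); lra.
by move=> k; rewrite /e'; case: ifP => // _; rewrite normrN1.
Qed.

End signs.

Section small_averages.
Context {R : realType} {T : circType}.

(** The number of points of a net grows linearly in [n], and so the sum of the
fourth powers of the balanced sums over the net grows like n^3; for [n] large
this is below (h n)^4, where [h] is half of [d]. The other half of [d] pays for
the passage from the net to all points. *)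
Lemma small_sign_average (f : nat -> T -> R) (C d : R) : 0 <= C -> 0 < d ->
    (forall k x s, cyclic_chain x s -> energy (f k) x s <= C ^+ 2) ->
  exists n, (0 < n)%N /\ exists2 e : nat -> R, (forall k, `|e k| = 1) &
    forall x, `|\sum_(k < n) e k * f k x| <= d * n%:R.
Proof.
move=> C0 d0 fC.
have fbnd k y : `|f k y| <= C.
  have := fC k y [::] isT; rewrite /energy /= addr0.
  by rewrite -(real_normK (num_real _)) ler_pXn2r ?nnegrE.
have [h h0 dh] : exists2 h, 0 < h & d = h + h.
  by exists (d / 2); [rewrite divr_gt0|field].
(* The bound for the sum of fourth powers is K n^3: the net has at most
   n C^2 / h^2 + 1 <= n (C^2 / h^2 + 1) points. *)
pose K := (C ^+ 2 / h ^+ 2 + 1) * (9 * C ^+ 4).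
have K0 : 0 <= K by rewrite !mulr_ge0 ?addr_ge0 ?divr_ge0 ?exprn_ge0// ltW.
pose n := (Num.Def.archi_bound (K / h ^+ 4)).+1.
have nK : K <= h ^+ 4 * n%:R.
  rewrite mulrC -ler_pdivrMr ?exprn_gt0//.
  have Kh : 0 <= K / h ^+ 4 by rewrite divr_ge0// exprn_ge0// ltW.
  apply: (le_trans (ltW (archi_boundP Kh))).
  by rewrite ler_nat /n.
have n0 : (0 < n)%N by [].
have n1 : 1 <= n%:R :> R by rewrite ler1n.
pose far : rel T := fun a b => [exists k : 'I_n, h < `|f k b - f k a|].
have farS : symmetric far.
  by move=> a b; apply: eq_existsb => k; rewrite distrC.
have farI : irreflexive far.
  by move=> a; apply/existsP => -[k]; rewrite subrr normr0 ltNge (ltW h0).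
pose B := n%:R * (C ^+ 2 / h ^+ 2).
have B0 : 0 <= B by rewrite !mulr_ge0 ?invr_ge0 ?exprn_ge0// ltW.
have bnd x s : cyclic_chain x s -> path far x s -> (size s)%:R <= B.
  move=> cs ps; rewrite /B mulrA ler_pdivlMr ?exprn_gt0// mulrC.
  have : path (fun a b => h ^+ 2 <= \sum_(k < n) (f k b - f k a) ^+ 2) x s.
    apply: sub_path ps => a b /existsP[k hk].
    rewrite (bigD1 k)//=; apply: ler_wpDr.
      by apply: sumr_ge0 => i _; exact: sqr_ge0.
    rewrite -[leRHS](real_normK (num_real _)).
    by apply: lerXn2r; rewrite ?nnegrE//; exact: ltW.
  move=> far_ps; apply: (le_trans (path_sum_size far_ps)).
  rewrite (path_sum_sum n (fun k a b => (f k b - f k a) ^+ 2)).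
  apply: (@le_trans _ _ (\sum_(k < n) C ^+ 2)).
    apply: ler_sum => k _; apply: le_trans (fC k x s cs).
    by rewrite /energy lerDr sqr_ge0.
  by rewrite sumr_const card_ord mulr_natl.
have [Y sY netY] := finite_net B0 farS farI bnd.
have [e e1 eY] := balanced_signs Y n (lexx 0) fbnd.
exists n; split => //; exists e => // x.
have [y yY] := netY x; rewrite negb_exists => /forallP yx.
have Sy : `|\sum_(k < n) e k * f k y| <= h * n%:R.
  rewrite -(@ler_pXn2r _ 4) ?nnegrE ?mulr_ge0 ?(ltW h0)//.
  rewrite -[4%N]/(2 * 2)%N exprM (real_normK (num_real _)).
  have : ((\sum_(k < n) e k * f k y) ^+ 2 + 0) ^+ 2 <=
      \sum_(y <- Y) ((\sum_(k < n) e k * f k y) ^+ 2 + 0) ^+ 2.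
    rewrite (big_rem y)//= lerDl; apply: sumr_ge0 => i _; exact: sqr_ge0.
  rewrite addr0 => /le_trans; apply; apply: (le_trans eY); rewrite addr0.
  apply: le_trans (ler_wpM2r (sqr_ge0 _) sY) _.
  apply: (@le_trans _ _ (K * n%:R ^+ 3)).
    have -> : K * n%:R ^+ 3 =
        (n%:R * (C ^+ 2 / h ^+ 2) + n%:R) * (3 * C ^+ 2 * n%:R) ^+ 2.
      by rewrite /K; ring.
    by apply: ler_wpM2r; [exact: sqr_ge0|rewrite /B lerD2l].
  have -> : (h * n%:R) ^+ (2 * 2) = (h ^+ 4 * n%:R) * n%:R ^+ 3 by ring.
  by apply: ler_wpM2r => //; rewrite exprn_ge0.
have -> : \sum_(k < n) e k * f k x =
    \sum_(k < n) e k * f k y + \sum_(k < n) e k * (f k x - f k y).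
  by rewrite -big_split/=; apply: eq_bigr => k _; ring.
have -> : d * n%:R = h * n%:R + h * n%:R by rewrite dh mulrDl.
apply: (le_trans (ler_normD _ _)); apply: lerD => //.
apply: (le_trans (ler_norm_sum _ _ _)).
apply: (@le_trans _ _ (\sum_(k < n) h)).
  by apply: ler_sum => k _; rewrite normrM e1 mul1r leNgt.
by rewrite sumr_const card_ord mulr_natr.
Qed.

End small_averages.

(** * The Banach space *)

Section variation_space.
Context {R : realType} {X : circTopologicalType}.
Implicit Types (f g : X -> R) (x : X) (s : seq X).

(** The closure of the continuous functions of bounded variation for the
quadratic variation norm. On the circle, all functions of finite quadratic
variation would be too many: the lacunary series sum_n a_n 2^(-n/2) cos(2^n t)
with bounded coefficients form a copy of the space of bounded sequences, which
contains l1. *)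
Definition energy_approximable f := forall e, 0 < e ->
  exists f0 : X -> R, [/\ continuous f0, chain_bounded f0 &
    forall x s, cyclic_chain x s -> energy (fun y => f y - f0 y) x s <= e].

Definition approximable_pred : {pred (X -> R)} :=
  [pred f | `[< energy_approximable f >]].

Lemma approximable_bounded f : energy_approximable f ->
  exists2 M, 0 <= M & forall x s, cyclic_chain x s -> energy f x s <= M.
Proof.
move=> /(_ 1 ltr01)[f0 [_ /chain_bounded_sup[M M0 [fM vM]] fe]].
exists (2 * 1 + 2 * (M ^+ 2 + 2 * M * M)).
  by rewrite addr_ge0 ?mulr_ge0 ?addr_ge0 ?sqr_ge0 ?mulr_ge0.
move=> x s cs.
have -> : f = (fun y => (f y - f0 y) + f0 y).
  by apply/funext => y; rewrite subrK.
apply: (le_trans (energyD2 _ _ _ _)); apply: lerD; apply: ler_wpM2l => //.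
  exact: fe.
by apply: energy_small => //; exact: vM.
Qed.

Fact approximable_submod : submod_closed approximable_pred.
Proof.
split.
  apply/asboolP => e e0; exists (fun=> 0); split.
  - exact: cst_continuous.
  - exists 0 => x s _; rewrite /chain_variation.
    rewrite -[leRHS](mul0r (path_sum (fun _ _ => 1) x s)) -path_sumZ.
    by apply: le_path_sum => a b; rewrite subrr normr0 mul0r.
  - move=> x s _.
    have -> : (fun y : X => (0 : X -> R) y - 0) = (fun y => 0 * 0).
      by apply/funext => y; rewrite subr0 mul0r.
    by rewrite energyZ expr0n mul0r ltW.
move=> k f g /asboolP fa /asboolP ga; apply/asboolP => e e0.
have k0 : 0 < 4 * (k ^+ 2 + 1) by rewrite mulr_gt0// ltr_wpDl ?sqr_ge0.
have [f0 [cf vf ef]] := fa (e / (4 * (k ^+ 2 + 1))) (divr_gt0 e0 k0).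
have e4 : 0 < e / 4 by rewrite divr_gt0.
have [g0 [cg vg eg]] := ga (e / 4) e4.
exists (fun y => k * f0 y + g0 y); split.
- move=> y; apply: cvgD; last exact: cg.
  by apply: cvgM; [exact: cvg_cst|exact: cf].
- by apply: chain_boundedD => //; exact: chain_bounded_mulr.
- move=> x s cs.
  have -> : (fun y : X => (k *: f + g) y - (k * f0 y + g0 y)) =
      (fun y => k * (f y - f0 y) + (g y - g0 y)).
    by apply/funext => y; rewrite mulrBr opprD addrACA.
  apply: (le_trans (energyD2 _ _ _ _)).
  have -> : e = 2 * (e / 4) + 2 * (e / 4) by field.
  apply: lerD; apply: ler_wpM2l => //; last exact: eg.
  rewrite energyZ; apply: le_trans (ler_wpM2l (sqr_ge0 _) (ef _ _ cs)) _.
  rewrite mulrCA ler_pM2l// ler_pdivrMr//.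
  have -> : 4^-1 * (4 * (k ^+ 2 + 1)) = k ^+ 2 + 1 by field.
  by rewrite lerDl.
Qed.

HB.instance Definition _ :=
  GRing.isSubmodClosed.Build R (X -> R) approximable_pred approximable_submod.

End variation_space.

Section variation_space_norm.
Variables (R : realType) (X : circTopologicalType).

Definition variation_space : Type :=
  {f : X -> R | f \in @approximable_pred R X}.

HB.instance Definition _ := SubChoice.on variation_space.
HB.instance Definition _ := [SubChoice_isSubLmodule of variation_space by <:].

Implicit Types (f g : variation_space) (x : X) (s : seq X).

Lemma variation_spaceP f : energy_approximable (val f).
Proof. exact/asboolP/(valP f). Qed.

(** For an empty [X] the supremum is that of the empty set, which is 0. *)
Definition variation_norm f : R :=
  sup [set r | exists x s,
    cyclic_chain x s /\ r = Num.sqrt (energy (val f) x s)].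


Lemma energy_le_norm f x s : cyclic_chain x s ->
  energy (val f) x s <= variation_norm f ^+ 2.
Proof.
move=> cs; have [M M0 fM] := approximable_bounded (variation_spaceP f).
have le_norm : Num.sqrt (energy (val f) x s) <= variation_norm f.
  apply: ub_le_sup; last by exists x, s.
  by exists (Num.sqrt M) => _ [y [t [ct ->]]]; rewrite ler_wsqrtr ?fM.
rewrite -[leLHS]sqr_sqrtr ?energy_ge0// lerXn2r ?nnegrE ?sqrtr_ge0//.
exact: le_trans le_norm.
Qed.

Lemma variation_norm_le f (A : R) : 0 <= A ->
    (forall x s, cyclic_chain x s -> energy (val f) x s <= A ^+ 2) ->
  variation_norm f <= A.
Proof.
move=> A0 fA; rewrite /variation_norm; set E := [set r | _].
have ubE : ubound E A.
  move=> _ [x [s [cs ->]]].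
  by rewrite -[A]ger0_norm// -sqrtr_sqr ler_wsqrtr ?fA.
have [E0|E0] := pselect (E !=set0); first exact: ge_sup.
suff -> : E = set0 by rewrite sup0.
by apply/seteqP; split=> // r Er; case: E0; exists r.
Qed.

Lemma variation_norm_ge0 f : 0 <= variation_norm f.
Proof.
have [[x _]|nX] := pselect (exists x : X, True).
  have [M M0 fM] := approximable_bounded (variation_spaceP f).
  apply: (@le_trans _ _ (Num.sqrt (energy (val f) x [::]))).
    exact: sqrtr_ge0.
  apply: ub_le_sup; last by exists x, [::].
  by exists (Num.sqrt M) => _ [y [t [ct ->]]]; rewrite ler_wsqrtr ?fM.
rewrite /variation_norm; set E := [set r | _].
suff -> : E = set0 by rewrite sup0.
by apply/seteqP; split=> // r [x _]; case: nX; exists x.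
Qed.

Lemma eval_le_norm f x : `|val f x| <= variation_norm f.
Proof.
rewrite -(@ler_pXn2r _ 2) ?nnegrE ?variation_norm_ge0//.
rewrite (real_normK (num_real _)).
by have := @energy_le_norm f x [::] isT; rewrite /energy addr0.
Qed.

(** The strict inequalities [0 < A] and [0 < B] of [energy_triangle] are
obtained by enlarging both norms by [h]. *)
Fact variation_normD f g :
  variation_norm (f + g) <= variation_norm f + variation_norm g.
Proof.
apply/ler_addgt0Pr => e e0.
pose h := e / 2; have h0 : 0 < h by rewrite divr_gt0.
have pos f' : 0 < variation_norm f' + h by rewrite ltr_wpDl ?variation_norm_ge0.
have le f' x s : cyclic_chain x s ->
    energy (val f') x s <= (variation_norm f' + h) ^+ 2.
  move=> cs; apply: (le_trans (energy_le_norm f' cs)).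
  by rewrite lerXn2r ?nnegrE ?variation_norm_ge0 ?(ltW (pos _))// lerDl ltW.
have -> : variation_norm f + variation_norm g + e =
    (variation_norm f + h) + (variation_norm g + h) by rewrite /h; field.
apply: variation_norm_le => [|x s cs]; first by rewrite addr_ge0// ltW.
exact: energy_triangle (pos f) (pos g) (le _ _ _ cs) (le _ _ _ cs).
Qed.

Fact variation_normZ (k : R) f :
  variation_norm (k *: f) = `|k| * variation_norm f.
Proof.
have leZ l g : variation_norm (l *: g) <= `|l| * variation_norm g.
  apply: variation_norm_le => [|x s cs].
    by rewrite mulr_ge0 ?variation_norm_ge0.
  rewrite [X in X <= _](energyZ l (val g)) exprMn (real_normK (num_real _)).
  by rewrite ler_wpM2l ?sqr_ge0 ?energy_le_norm.
apply/eqP; rewrite eq_le leZ /=.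
have [->|k0] := eqVneq k 0; first by rewrite normr0 mul0r variation_norm_ge0.
rewrite -ler_pdivlMl ?normr_gt0// -normfV.
by have := leZ k^-1 (k *: f); rewrite scalerA mulVf// scale1r.
Qed.

Fact variation_norm_eq0 f : variation_norm f = 0 -> f = 0.
Proof.
move=> f0; apply/val_inj/funext => x; apply/eqP.
by change (val f x == 0 :> R); rewrite -normr_le0 -f0 eval_le_norm.
Qed.

HB.instance Definition _ := Lmodule_isNormed.Build R variation_space
  variation_normD variation_normZ variation_norm_eq0.

Lemma norm_variationE f : `|f| = variation_norm f.
Proof. by []. Qed.

End variation_space_norm.

Section completeness.
Context {R : realType} {X : circTopologicalType}.
Local Notation V := (variation_space R X).

Lemma cvg_path_sum {I : Type} (F : set_system I) {FF : Filter F}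
    (w : I -> X -> X -> R) (w0 : X -> X -> R) x s :
    (forall a b, w i a b @[i --> F] --> w0 a b) ->
  path_sum (w i) x s @[i --> F] --> path_sum w0 x s.
Proof.
move=> ww; elim: s x => [|y s IH] x /=; first exact: cvg_cst.
by apply: cvgD; [exact: ww|exact: IH].
Qed.

Lemma cvg_energy {I : Type} (F : set_system I) {FF : Filter F}
    (f : I -> X -> R) (f0 : X -> R) x s :
    (forall y, f i y @[i --> F] --> f0 y) ->
  energy (f i) x s @[i --> F] --> energy f0 x s.
Proof.
move=> ff; apply: cvgD; first by apply: cvgM; exact: ff.
apply: (@cvg_path_sum _ _ _ (fun i a b => (f i b - f i a) ^+ 2)) => a b.
by apply: cvgM; apply: cvgB; exact: ff.
Qed.

(** The pointwise limit is the limit in norm because each energy depends on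
finitely many values only. *)
Lemma variation_space_complete (F : set_system V) :
  ProperFilter F -> cauchy F -> cvg F.
Proof.
move=> FF /cauchyP Fc.
have cvF x : cvg (val f x @[f --> F]).
  apply: cauchy_cvg; apply/cauchyP => e e0; have [g Fg] := Fc e e0.
  exists (val g x); rewrite /= nbhs_simpl /=; apply: filterS Fg => f.
  rewrite -!ball_normE /= => fg.
  exact: le_lt_trans (eval_le_norm (g - f) x) fg.
pose f0 x : R := lim (val f x @[f --> F]).
have limE (h : V) e x s : 0 < e -> F (ball h e) -> cyclic_chain x s ->
    energy (fun y => f0 y - val h y) x s <= e ^+ 2.
  move=> e0 Fh cs.
  have c : energy (fun y => val f y - val h y) x s @[f --> F] -->
      energy (fun y => f0 y - val h y) x s.
    apply: cvg_energy => y; apply: cvgB; [exact: cvF|exact: cvg_cst].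
  rewrite -(cvg_lim _ c)//; apply: limr_le.
    by apply/cvg_ex; eexists; exact: c.
  apply: filterS Fh => f; rewrite -ball_normE /= distrC norm_variationE => hf.
  apply: (le_trans (energy_le_norm (f - h) cs)).
  by rewrite lerXn2r ?nnegrE ?variation_norm_ge0 ?ltW.
have f0V : f0 \in @approximable_pred R X.
  apply/asboolP => e e0.
  have [r r0 re] : exists2 r : R, 0 < r & 2 * r ^+ 2 + 2 * r ^+ 2 <= e.
    exists (Num.sqrt (e / 4)); first by rewrite sqrtr_gt0 divr_gt0.
    have e4 : 0 <= e / 4 by rewrite divr_ge0// ltW.
    by rewrite sqr_sqrtr//; lra.
  have [h Fh] := Fc r r0.
  have [h0 [ch vh eh]] := variation_spaceP h (exprn_gt0 2 r0).
  exists h0; split => // x s cs.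
  have -> : (fun y => f0 y - h0 y) =
      (fun y => (f0 y - val h y) + (val h y - h0 y)).
    by apply/funext => y; rewrite addrA subrK.
  apply: (le_trans (energyD2 _ _ _ _)); apply: le_trans re.
  by apply: lerD; apply: ler_wpM2l => //; [exact: limE|exact: eh].
apply/cvg_ex; exists (Sub f0 f0V : V).
apply/cvgrPdist_le => e e0; have h0 : 0 < e / 2 by rewrite divr_gt0.
have [h Fh] := Fc _ h0; apply: filterS (Fh) => f.
rewrite -ball_normE /= => hf.
have -> : e = e / 2 + e / 2 by field.
have -> : (Sub f0 f0V : V) - f = (Sub f0 f0V - h) + (h - f).
  by rewrite addrA subrK.
apply: (le_trans (ler_normD _ _)); apply: lerD; last exact: ltW.
apply: variation_norm_le => [|x s cs]; first exact: ltW.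
exact: limE.
Qed.

HB.instance Definition _ := Uniform_isComplete.Build V variation_space_complete.

End completeness.


(** * Absence of copies of l1 *)

Section no_ell1.
Context {R : realType} {X : circTopologicalType}.
Local Notation V := (variation_space R X).

Lemma val_sum (I : Type) (r : seq I) (F : I -> V) x :
  val (\sum_(i <- r) F i) x = \sum_(i <- r) val (F i) x.
Proof. by elim/big_ind2 : _ => // f a g b <- <-. Qed.

(** Here [e] is shared equally between the three error terms of
[energy_near_orthogonal], whence the constants in [t] and [r]. *)
Lemma norm_near_orthogonal (f : V) (C e : R) : 0 <= C -> 0 < e ->
  exists2 r, 0 < r & forall g : V, `|g| <= C -> (forall x, `|val g x| <= r) ->
    `|f + g| ^+ 2 <= `|f| ^+ 2 + `|g| ^+ 2 + e.
Proof.
move=> C0 e0.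
pose t := e / (3 * (C ^+ 2 + 1)).
have C1 : 0 < C ^+ 2 + 1 by rewrite ltr_wpDl ?sqr_ge0.
have t0 : 0 < t by rewrite divr_gt0// mulr_gt0.
have te : 0 < t * e / 3 by rewrite divr_gt0// mulr_gt0.
have [f0 [_ /chain_bounded_sup[M M0 [f0M vM]] fe]] :=
  variation_spaceP f te.
pose r := e / (18 * (M + 1)).
have M1 : 0 < M + 1 by rewrite ltr_wpDl.
have r0 : 0 < r by rewrite divr_gt0// mulr_gt0.
exists r => // g gC gr.
have fg0 : 0 <= `|f| ^+ 2 + `|g| ^+ 2 + e by rewrite !addr_ge0 ?sqr_ge0// ltW.
rewrite -[leRHS]sqr_sqrtr// lerXn2r ?nnegrE ?sqrtr_ge0//.
apply: variation_norm_le; rewrite ?sqrtr_ge0// => x s cs; rewrite sqr_sqrtr//.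
apply: (le_trans (energy_near_orthogonal (val f) f0 x s (ltW r0) t0 gr)).
have fx := energy_le_norm f cs; have gx := energy_le_norm g cs.
rewrite -!norm_variationE in fx gx.
have g2 : `|g| ^+ 2 <= C ^+ 2 by rewrite lerXn2r ?nnegrE.
have tg : t * energy (val g) x s <= e / 3.
  apply: (@le_trans _ _ (t * (C ^+ 2 + 1))).
    by rewrite ler_wpM2l ?(ltW t0)//; lra.
  by rewrite /t invfM mulrA divfK// gt_eqF.
have tf : t^-1 * energy (fun y => val f y - f0 y) x s <= e / 3.
  by rewrite ler_pdivrMl// mulrA fe.
have rf : 2 * r * (`|f0 x| + 2 * chain_variation f0 x s) <= e / 3.
  apply: (@le_trans _ _ (2 * r * (3 * (M + 1)))).
    apply: ler_wpM2l; first by rewrite mulr_ge0// ltW.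
    by have := f0M x; have := vM x s cs; lra.
  suff -> : 2 * r * (3 * (M + 1)) = e / 3 by [].
  by rewrite /r; field; rewrite gt_eqF.
lra.
Qed.

(** Normalized form of [small_sign_average]: the coefficients have absolute sum
one, so that the combination is still bounded in norm by [C]. *)
Lemma small_average (f : nat -> V) (C d : R) : 0 <= C -> 0 < d ->
    (forall k, `|f k| <= C) ->
  exists n, exists2 c : nat -> R, \sum_(k < n) `|c k| = 1 &
    `|\sum_(k < n) c k *: f k| <= C /\
    forall x, `|val (\sum_(k < n) c k *: f k) x| <= d.
Proof.
move=> C0 d0 fC.
have [|n [n0 [e e1 small]]] :=
    @small_sign_average R X (fun k => val (f k)) C d C0 d0.
  move=> k x s /(energy_le_norm (f k))/le_trans; apply.
  by rewrite -norm_variationE lerXn2r ?nnegrE.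
have n0R : 0 < n%:R :> R by rewrite ltr0n.
exists n, (fun k => n%:R^-1 * e k).
  under eq_bigr do rewrite normrM e1 mulr1 normfV normr_nat.
  by rewrite sumr_const card_ord -[LHS]mulr_natr mulVf// gt_eqF.
split=> [|x].
  apply: (le_trans (ler_norm_sum _ _ _)).
  apply: (@le_trans _ _ (\sum_(k < n) n%:R^-1 * C)).
    apply: ler_sum => k _; rewrite normrZ normrM e1 mulr1 normfV normr_nat.
    by rewrite ler_wpM2l// invr_ge0 ltW.
  by rewrite sumr_const card_ord -[leLHS]mulr_natr mulrAC mulVf ?mul1r// gt_eqF.
rewrite val_sum.
have -> : \sum_(k < n) val ((n%:R^-1 * e k) *: f k) x =
    n%:R^-1 * \sum_(k < n) e k * val (f k) x.
  by rewrite mulr_sumr; apply: eq_bigr => k _; rewrite mulrA.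
by rewrite normrM normfV normr_nat mulrC ler_pdivrMr.
Qed.

(** A gliding hump: to a combination of absolute sum [j] one adds a uniformly
small average of later terms, which by near orthogonality increases the square
of the norm by at most [C ^+ 2 + 1]. The norms then grow like the square root of
[j], which contradicts a lower bound linear in [j]. *)
Lemma no_ell1_sequence (f : nat -> V) (C d : R) : 0 < d ->
    (forall k, `|f k| <= C) ->
  ~ (forall n (c : nat -> R),
      d * \sum_(k < n) `|c k| <= `|\sum_(k < n) c k *: f k|).
Proof.
move=> d0 fC low.
have C0 : 0 <= C by exact: le_trans (fC 0%N).
have upper j : exists n, exists2 c : nat -> R, \sum_(k < n) `|c k| = j%:R &
    `|\sum_(k < n) c k *: f k| ^+ 2 <= j%:R * (C ^+ 2 + 1).
  elim: j => [|j [n [c cj fj]]].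
    by exists 0%N, (fun=> 0); rewrite !big_ord0// normr0 expr0n mul0r.
  set S := \sum_(k < n) _ in fj.
  have [r r0 ortho] := norm_near_orthogonal S C0 ltr01.
  have [m [b b1 [bC bsmall]]] :=
    @small_average (fun k => f (n + k)%N) C r C0 r0 (fun k => fC _).
  pose c' k := if (k < n)%N then c k else b (k - n)%N.
  have c'l (k : 'I_n) : c' k = c k by rewrite /c' ltn_ord.
  have c'r (k : 'I_m) : c' (n + k)%N = b k.
    by rewrite /c' ltnNge leq_addr/= addKn.
  exists (n + m)%N, c'.
    rewrite big_split_ord /=; under eq_bigr do rewrite c'l.
    by rewrite cj; under eq_bigr do rewrite c'r; rewrite b1 natr1.
  rewrite big_split_ord /=.
  have -> : \sum_(i < n) c' i *: f i = S by apply: eq_bigr => k _; rewrite c'l.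
  have -> : \sum_(i < m) c' (n + i)%N *: f (n + i)%N =
      \sum_(k < m) b k *: f (n + k)%N.
    by apply: eq_bigr => k _; rewrite c'r.
  apply: (le_trans (ortho _ bC bsmall)).
  rewrite -natr1 mulrDl mul1r -addrA; apply: lerD => //; apply: lerD => //.
  by rewrite lerXn2r ?nnegrE.
have D0 : 0 < C ^+ 2 + 1 by rewrite ltr_wpDl ?sqr_ge0.
have q0 : 0 <= (C ^+ 2 + 1) / d ^+ 2 by rewrite divr_ge0 ?sqr_ge0 ?(ltW D0).
have := archi_boundP q0; set j := Num.Def.archi_bound _.
rewrite ltr_pdivrMr ?exprn_gt0// => jbig.
have j0 : 0 < j%:R :> R.
  by rewrite -(pmulr_lgt0 _ (exprn_gt0 2 d0)); exact: lt_trans jbig.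
have [n [c cj fj]] := upper j.
have := low n c; rewrite cj => lowj.
have : (d * j%:R) ^+ 2 <= j%:R * (C ^+ 2 + 1).
  apply: le_trans fj; rewrite lerXn2r ?nnegrE//.
  by rewrite mulr_ge0// ltW.
rewrite exprMn expr2 expr2 -!expr2 [j%:R ^+ 2]expr2 mulrCA ler_pM2l//.
by rewrite mulrC leNgt jbig.
Qed.

Lemma ell1_finite n (c : nat -> R) :
  exists2 u : ell1 R, (forall i, val u i = if (i < n)%N then c i else 0) &
    `|u| = \sum_(k < n) `|c k|.
Proof.
pose u i := if (i < n)%N then c i else 0.
have near_const : \forall m \near \oo,
    \sum_(k < n) `|c k| = series (fun i => `|u i|) m.
  exists n => // m /= nm; rewrite /series /= -[m in RHS](subnKC nm).
  rewrite big_mkord big_split_ord/= [X in _ + X]big1 ?addr0.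
    by apply: eq_bigr => k _; rewrite /u ltn_ord.
  by move=> k _; rewrite /u ltnNge leq_addr normr0.
have cu : series (fun i => `|u i|) @ \oo --> \sum_(k < n) `|c k|.
  by apply: cvg_near_cst; apply: filterS near_const => m ->.
have us : u \in @summable_seq R.
  by apply/summable_seqP/cvg_ex; eexists; exact: cu.
by exists (Sub u us) => //; exact: cvg_lim cu.
Qed.

(** Openness of an embedding at 0 gives the lower bound, and continuity at 0 the
upper bound, that turn the images of the unit vectors into a sequence excluded
by [no_ell1_sequence]. *)
Lemma variation_space_rosenthal : rosenthal V.
Proof.
move=> [F [Finj Fcont Fopen]].
have [r r0 low] : exists2 r : R, 0 < r & forall u, r * `|u| <= `|F u|.
  have [B oB imE] := Fopen (ball 0 1) (ball_open _ _).
  have : nbhs (0 : V) B.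
    apply: open_nbhs_nbhs; split => //.
    have : (F @` ball (0 : ell1 R) 1) 0.
      by exists 0; [exact: ballxx|rewrite raddf0].
    by rewrite imE => -[].
  move=> /nbhs_ballP[r /= r0 rB]; exists r => // u.
  rewrite leNgt; apply/negP => small.
  have u0 : 0 < `|u|.
    by rewrite -(pmulr_rgt0 _ r0); exact: le_lt_trans (normr_ge0 _) small.
  have : (F @` ball (0 : ell1 R) 1) (F (`|u|^-1 *: u)).
    rewrite imE; split; last by exists (`|u|^-1 *: u).
    apply: rB; rewrite -ball_normE /= sub0r normrN linearZ normrZ.
    by rewrite normfV normr_id mulrC ltr_pdivrMr.
  move=> [v + /Finj vu]; rewrite vu -ball_normE /= sub0r normrN normrZ.
  by rewrite normfV normr_id mulVf ?ltxx// gt_eqF.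
have [q q0 up] : exists2 q : R, 0 < q & forall u, `|u| < q -> `|F u| < 1.
  have := Fcont 0; rewrite /continuous_at raddf0 => /cvgrPdist_lt/(_ 1 ltr01).
  move=> /nbhs_ballP[q /= q0 qF]; exists q => // u uq.
  have := qF u; rewrite -ball_normE /= !sub0r !normrN; exact.
have /choice[e eE] : forall k, exists u : ell1 R,
    (forall i, val u i = (i == k)%:R) /\ `|u| = 1.
  move=> k; have [u uE un] := ell1_finite k.+1 (fun i => (i == k)%:R).
  exists u; split => [i|].
    rewrite uE; case: ltnP => // ki; suff -> : (i == k) = false by [].
    by rewrite gtn_eqF.
  rewrite un big_ord_recr /= eqxx normr1 big1 ?add0r// => i _.
  by rewrite ltn_eqF ?normr0.
apply: (@no_ell1_sequence (fun k => F (e k)) (2 / q) r r0) => [k|n c].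
  have : `|F ((q / 2) *: e k)| < 1.
    apply: up; rewrite normrZ (eE k).2 mulr1 ger0_norm; last first.
      by rewrite divr_ge0// ltW.
    by rewrite ltr_pdivrMr// ltr_pMr// ltr1n.
  rewrite linearZ normrZ ger0_norm; last by rewrite divr_ge0// ltW.
  move=> /ltW; rewrite -ler_pdivlMl ?divr_gt0// mulr1 invf_div; exact.
have [u uE un] := ell1_finite n c.
rewrite -un; apply: (le_trans (low u)).
suff -> : u = \sum_(k < n) c k *: e k.
  rewrite raddf_sum; have -> // : \sum_(k < n) F (c k *: e k) =
    \sum_(k < n) c k *: F (e k) by apply: eq_bigr => k _; rewrite linearZ.
apply/val_inj/funext => i.
have -> : val (\sum_(k < n) c k *: e k) i = \sum_(k < n) c k * val (e k) i.
  by elim/big_ind2 : _ => // a b a' b' <- <-.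
rewrite uE; case: ltnP => [ni|ni].
  rewrite (bigD1 (Ordinal ni))//= (eE _).1 eqxx mulr1 big1 ?addr0// => k ki.
  by rewrite (eE k).1 -val_eqE /= in ki *; rewrite eq_sym (negbTE ki) mulr0.
by rewrite big1// => k _; rewrite (eE k).1 gtn_eqF ?mulr0// (leq_trans _ ni).
Qed.

End no_ell1.

(** * The interval topology *)

Section arcs.
Context {X : circTopologicalType}.
Implicit Types (a b c x y z : X).

Lemma cord_mid c x y z : cord c x y -> cord c y z -> cord x y z.
Proof.
move=> cxy cyz; apply/cord_cyclic/cord_cyclic.
exact: cord_trans (cord_cyclic (cord_cyclic (cord_cyclic (cord_cyclic cyz))))
  (cord_cyclic (cord_cyclic cxy)).
Qed.

Lemma oarc_open a b : open (oarc a b).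
Proof.
rewrite open_arcE; right => x axb; exists a, b; split => //.
by have [_ _] := cord_neq axb.
Qed.

Lemma arc_openE (A : set X) : open A = arc_open A.
Proof. by rewrite open_arcE. Qed.

Lemma nbhs_oarc x (N : set X) : nbhs x N ->
  (forall A : set X, @open X A) \/ exists a b, cord a x b /\ oarc a b `<=` N.
Proof.
rewrite nbhsE => -[B [oB Bx] BN]; move: oB; rewrite arc_openE => -[h|h].
  by left=> A; rewrite arc_openE; left.
have [a [b [_ axb sub]]] := h x Bx.
by right; exists a, b; split => // y /sub/BN.
Qed.

(** Two points are separated by arcs that end at points chosen between them; on
a side where there is no point in between, the arcs end at the opposite one of
the two points. *)
Lemma circ_separated a b : a <> b -> exists A B : set X,
  [/\ open A, open B, A a, B b & A `&` B = set0].
Proof.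
move=> ab.
have one_side p q d : cord q d p -> ~ (exists c, cord p c q) ->
    [/\ oarc d q p, oarc p d q & oarc d q `&` oarc p d = set0].
  move=> qdp nc; split; [exact: cord_cyclic|exact/cord_cyclic/cord_cyclic|].
  rewrite -subset0 => y [dyq pyd]; apply: nc; exists y.
  by apply: (cord_mid _ dyq); exact/cord_cyclic/cord_cyclic.
have [[c acb]|nc] := pselect (exists c, cord a c b);
    have [[d bda]|nd] := pselect (exists d, cord b d a).
- exists (oarc d c), (oarc c d).
  split; [exact: oarc_open|exact: oarc_open| | |].
  + apply/cord_cyclic/cord_cyclic.
    exact: cord_trans acb (cord_cyclic (cord_cyclic bda)).
  + apply/cord_cyclic/cord_cyclic.
    exact: cord_trans bda (cord_cyclic (cord_cyclic acb)).
  + rewrite -subset0 => y [dyc cyd].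
    exact: (cord_asym (cord_cyclic dyc) (cord_cyclic cyd)).
- have [pb pa dis] := one_side _ _ _ acb nd.
  exists (oarc b c), (oarc c a); split => //; try exact: oarc_open.
  by rewrite setIC.
- have [pa pb dis] := one_side _ _ _ bda nc.
  by exists (oarc d b), (oarc a d); split => //; exact: oarc_open.
- have two z : z = a \/ z = b.
    have [->|za] := pselect (z = a); first by left.
    have [->|zb] := pselect (z = b); first by right.
    have [h|h] := cord_total (nesym za) zb ab; first by case: nc; exists z.
    by case: nd; exists z; apply: cord_cyclic.
  have oA (A : set X) : @open X A.
    rewrite arc_openE; left => p q r.
    case: (two p) (two q) (two r) => -> [] -> [] ->;
      by [apply: Or31|apply: Or32|apply: Or33].
  exists [set a], [set b]; split => //.
  by rewrite -subset0 => y [-> /ab].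
Qed.

Lemma circ_hausdorff : hausdorff_space X.
Proof.
rewrite open_hausdorff => a b /eqP/circ_separated[A [B [oA oB Aa Bb AB0]]].
by exists (A, B); [split; rewrite inE|split => //; apply/eqP].
Qed.

(** Cutting the circle outside an open arc does not break the arc, which is then
an interval of the cut order. *)
Lemma oarc_cut_convex c a b x y z : oarc a b x -> oarc a b y -> ~ oarc a b c ->
  cutlt c x z -> cutlt c z y -> oarc a b z.
Proof.
rewrite /oarc /= => axb ayb nc xz zy.
have xc : x <> c by move=> e; rewrite e in axb.
have cxz := cutlt_cord xc xz.
have czy := cutlt_cord (cutlt_neq_base xz) zy.
have [_ _ ab] := cord_neq axb.
have [ac|ac] := pselect (a = c).
  rewrite ac in ayb *; exact: cord_trans czy ayb.
have caz : cord c a z.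
  apply: cord_trans cxz.
  have [bc|bc] := pselect (b = c).
    by rewrite -bc; exact/cord_cyclic/cord_cyclic.
  have [abc|/nc//] := cord_total ab bc ac.
  by apply/cord_cyclic/cord_cyclic; exact: cord_trans axb abc.
have [bc|bc] := pselect (b = c); first by rewrite bc; exact: cord_cyclic.
have [abc|/nc//] := cord_total ab bc ac.
apply: (cord_mid caz); apply: (cord_trans czy).
exact: cord_cyclic (cord_cyclic (cord_mid ayb abc)).
Qed.

End arcs.

(** * Continuous bump functions of bounded variation *)

Section infimum.
Context {R : realType} {T : Type}.
Variable u : T -> R.
Hypothesis u01 : forall y, 0 <= u y <= 1.
Implicit Types (A B O : set T) (y z : T).

Definition infimum (A : set T) : R := inf (u @` A).

Lemma infimum_le A y : A y -> infimum A <= u y.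
Proof.
move=> Ay; apply: ge_inf; last by exists y.
by exists 0 => _ [z _ <-]; case/andP: (u01 z).
Qed.

Lemma le_infimum A y (r : R) : A y -> (forall z, A z -> r <= u z) ->
  r <= infimum A.
Proof.
move=> Ay rA; apply: lb_le_inf; first by exists (u y), y.
by move=> _ [z Az <-]; exact: rA.
Qed.

(** A point of one set outside the other lies in [O], where its value is within
[e] of the value at a point of the other set. *)
Lemma infimum_near (O A B : set T) y z (e : R) :
    (forall p q, O p -> O q -> `|u p - u q| <= e) ->
    O y -> O z -> A y -> B z -> A `<=` B `|` O -> B `<=` A `|` O ->
  `|infimum A - infimum B| <= e.
Proof.
move=> Oe Oy Oz Ay Bz AB BA.
have e0 : 0 <= e by have := Oe _ _ Oy Oy; rewrite subrr normr0.
have half (C D : set T) p q : O p -> C q -> D p -> C `<=` D `|` O ->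
    infimum D - e <= infimum C.
  move=> Op Cq Dp CD; apply: (le_infimum Cq) => w /CD[Dw|Ow].
    by have := infimum_le Dw; lra.
  have := Oe _ _ Op Ow; rewrite ler_norml => /andP[_].
  by have := infimum_le Dp; lra.
have := half _ _ _ _ Oz Ay Bz AB; have := half _ _ _ _ Oy Bz Ay BA.
rewrite ler_norml; lra.
Qed.

Lemma infimum_itv A y : A y -> 0 <= infimum A <= 1.
Proof.
move=> Ay; apply/andP; split.
  by apply: (le_infimum Ay) => z _; case/andP: (u01 z).
by apply: le_trans (infimum_le Ay) _; case/andP: (u01 y).
Qed.

End infimum.

Section bump.
Context {R : realType} {X : circTopologicalType}.
Implicit Types (c x y z : X) (u h : X -> R).

(** Along a chain based at [x] a function that decreases in the order cut at [c]
decreases, except at the one step that passes [c]. The induction hypothesis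
therefore carries a reserve of 4 as long as [c] is still ahead; the step over
[c] costs at most 2, and the value drops anew from a level higher by at most 2.
*)
Lemma cut_monotone_chain_bounded c h : (forall y, `|h y| <= 1) ->
  (forall y z, cutlt c y z -> h z <= h y) -> chain_bounded h.
Proof.
move=> h1 hmono; exists 6 => x s cs.
have rng y : -1 <= h y <= 1 by rewrite -ler_norml.
apply: (@le_trans _ _ (h x + 1 + 4 * (cutlt x x c)%:R)); last first.
  by have := rng x; case: cutlt => /=; lra.
move: cs; rewrite /cyclic_chain /chain_variation.
elim: s {2 3 4 6}x => [|z s IH] y /=.
  by have := rng y; case: cutlt => /=; lra.
move=> /andP[yz zs].
apply: le_trans (lerD (lexx _) (IH z zs)) _.
have ry := rng y; have rz := rng z.
have [same|] := eqVneq (cutlt x y c) (cutlt x z c).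
  have hzy := hmono _ _ (cutlt_rebase yz same).
  rewrite same ler0_norm; lra.
case yc: (cutlt x y c); case zc: (cutlt x z c) => // _.
- have : `|h z - h y| <= 2 by rewrite ler_norml; lra.
  rewrite /=; lra.
- by move: yc; rewrite (cutlt_trans yz zc).
Qed.

Lemma chain_bounded_max f h : chain_bounded f -> chain_bounded h ->
  @chain_bounded R X (fun y => Num.max (f y) (h y)).
Proof.
move=> [M fM] [N hN]; exists (M + N) => x s cs.
apply: le_trans (lerD (fM _ _ cs) (hN _ _ cs)).
rewrite -path_sumD; apply: le_path_sum => a b.
have := ler_norm (f b - f a); have := ler_norm (h b - h a).
have := ler_norm (- (f b - f a)); have := ler_norm (- (h b - h a)).
rewrite !normrN ler_norml /Num.max /=.
by case: (ltP (f b) (h b)); case: (ltP (f a) (h a)); lra.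
Qed.

Section envelope.
Variables (c : X) (u : X -> R).
Hypothesis u01 : forall y, 0 <= u y <= 1.
Local Notation infimum := (infimum u).

Definition lower y := [set z | ~~ cutlt c y z].
Definition upper y := [set z | ~~ cutlt c z y].

(** In the order cut at [c], the points below [y] form the arc from [c] to [y],
and those above [y] the arc from [y] back to [c]. The larger of the two infima
of [u] is, when [u] is maximal at [c], the largest function below [u] whose
superlevel sets are arcs through [c]. *)
Definition hull y : R := Num.max (infimum (lower y)) (infimum (upper y)).

Lemma lower_refl y : lower y y. Proof. by rewrite /lower /= cutlt_irr. Qed.
Lemma upper_refl y : upper y y. Proof. by rewrite /upper /= cutlt_irr. Qed.

Lemma hull_le y : hull y <= u y.
Proof.
rewrite /hull ge_max (infimum_le u01 (lower_refl y)).
exact: (infimum_le u01 (upper_refl y)).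
Qed.

Lemma hull_chain_bounded : chain_bounded hull.
Proof.
apply: chain_bounded_max.
  apply: (@cut_monotone_chain_bounded c) => [y|y z yz].
    by have := infimum_itv u01 (lower_refl y); rewrite ler_norml; lra.
  apply: (le_infimum (lower_refl y)) => w yw; apply: (infimum_le u01).
  by apply: contraNN yw => zw; exact: cutlt_trans yz zw.
have -> : (fun y => infimum (upper y)) =
    (fun y => -1 * (-1 * infimum (upper y))).
  by apply/funext => y; ring.
apply: chain_bounded_mulr; apply: (@cut_monotone_chain_bounded c) => [y|y z yz].
  by have := infimum_itv u01 (upper_refl y); rewrite ler_norml; lra.
rewrite !mulN1r lerN2; apply: (le_infimum (upper_refl z)) => w zw.
apply: (infimum_le u01); apply: contraNN zw => wy; exact: cutlt_trans wy yz.
Qed.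

Lemma lower_base z : lower c z -> z = c.
Proof.
by move=> cz; apply: contrapT => zc; move: cz; rewrite /lower /= cutlt_base.
Qed.

Lemma hull_base : u c = 1 -> hull c = 1.
Proof.
move=> uc; apply/eqP; rewrite eq_le -{1}uc hull_le /=.
rewrite /hull le_max; apply/orP; left.
by apply: (le_infimum (lower_refl c)) => z /lower_base ->; rewrite uc.
Qed.

(** When [y] moves inside an arc that avoids [c], the arcs that join [y] to [c]
change only by points of that arc. *)
Lemma hull_near (a b y z : X) (e : R) : ~ oarc a b c ->
    (forall p q, oarc a b p -> oarc a b q -> `|u p - u q| <= e) ->
    oarc a b y -> oarc a b z -> `|hull y - hull z| <= e.
Proof.
move=> nc osc aby abz.
have below p q : oarc a b p -> oarc a b q ->
    lower p `<=` lower q `|` oarc a b.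
  move=> abp abq w pw.
  case qw: (cutlt c q w); last by left; rewrite /lower /= qw.
  right; have [->//|wp] := pselect (w = p).
  apply: (oarc_cut_convex abq abp nc qw).
  by have := cutlt_total c wp; rewrite (negbTE pw) orbF.
have above p q : oarc a b p -> oarc a b q ->
    upper p `<=` upper q `|` oarc a b.
  move=> abp abq w pw.
  case wq: (cutlt c w q); last by left; rewrite /upper /= wq.
  right; have [->//|wp] := pselect (w = p).
  apply: (oarc_cut_convex abp abq nc _ wq).
  by have := cutlt_total c wp; rewrite (negbTE pw).
have := infimum_near u01 osc aby abz (lower_refl y) (lower_refl z)
  (below _ _ aby abz) (below _ _ abz aby).
have := infimum_near u01 osc aby abz (upper_refl y) (upper_refl z)
  (above _ _ aby abz) (above _ _ abz aby).
rewrite !ler_norml /hull /Num.max.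
set p := infimum (lower y); set q := infimum (upper y).
set p1 := infimum (lower z); set q1 := infimum (upper z).
by case: (ltP p q); case: (ltP p1 q1); lra.
Qed.

(** Near [c] the two infima behave differently: one of the arcs that join [y] to
[c] is short, while the other goes around. This is why the larger infimum is
taken. *)
Lemma hull_near_base (a b y : X) (r : R) : oarc a b c ->
  (forall p, oarc a b p -> r <= u p) -> oarc a b y -> r <= hull y.
Proof.
move=> acb ur ayb; rewrite /hull le_max; apply/orP.
have [yc|yc] := pselect (y = c).
  left; apply: (le_infimum (lower_refl y)) => w; rewrite yc => /lower_base ->.
  exact: ur.
have [_ yb _] := cord_neq ayb; have [_ cb _] := cord_neq acb.
have [cyb|cby] := cord_total (nesym yc) yb cb.
  left; apply: (le_infimum (lower_refl y)) => w yw; apply: ur.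
  have [->//|wy] := pselect (w = y); have [->//|wc] := pselect (w = c).
  have cwy : cord c w y.
    apply: (cutlt_cord wc).
    by have := cutlt_total c wy; rewrite (negbTE yw) orbF.
  have bcw := cord_cyclic (cord_cyclic (cord_trans cwy cyb)).
  exact: cord_cyclic (cord_trans (cord_cyclic (cord_cyclic acb)) bcw).
right; apply: (le_infimum (upper_refl y)) => w wy; apply: ur.
have [->//|wDy] := pselect (w = y).
have cyw : cord c y w.
  by apply: (cutlt_cord yc); have := cutlt_total c wDy; rewrite (negbTE wy).
have ayc := cord_mid (cord_cyclic (cord_cyclic ayb)) (cord_cyclic cby).
have caw := cord_trans (cord_cyclic (cord_cyclic ayc)) cyw.
exact: cord_trans (cord_cyclic caw) acb.
Qed.

Lemma hull_continuous : continuous u -> u c = 1 -> continuous hull.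
Proof.
move=> cu uc y; apply/cvgrPdist_le => e e0.
have e2 : 0 < e / 2 by rewrite divr_gt0.
have nu : nbhs y [set z | `|u y - u z| <= e / 2].
  by have /cvgrPdist_le := cu y; apply.
have discrete : (forall A : set X, open A) ->
    nbhs y [set z | `|hull y - hull z| <= e].
  move=> oA; apply: (@filterS _ _ _ [set y]) => [_ ->|].
    by rewrite /= subrr normr0 ltW.
  by apply: open_nbhs_nbhs; split => //; exact: oA.
have [yc|yc] := pselect (y = c).
  have [/discrete//|[a [b [ayb sub]]]] := nbhs_oarc nu.
  apply: filterS (open_nbhs_nbhs (conj (oarc_open a b) ayb)) => z azb.
  rewrite yc in ayb sub *; rewrite (hull_base uc).
  have : 1 - e <= hull z.
    apply: (hull_near_base ayb) azb => p /sub; rewrite /= uc ler_norml; lra.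
  have := hull_le z; have := u01 z; rewrite ler_norml; lra.
have nc : nbhs y (~` [set c]).
  have [A [B [oA oB Ay Bc AB0]]] := circ_separated yc.
  apply: filterS (open_nbhs_nbhs (conj oA Ay)) => z Az zc.
  by have : (A `&` B) c; [rewrite zc in Az; split|rewrite AB0].
have [/discrete//|[a [b [ayb sub]]]] := nbhs_oarc (filterI nu nc).
apply: filterS (open_nbhs_nbhs (conj (oarc_open a b) ayb)) => z azb.
apply: hull_near ayb azb => [/sub[_]|p q /sub[/= yp _] /sub[/= yq _]].
  exact.
by move: yp yq; rewrite !ler_norml; lra.
Qed.

End envelope.

Lemma variation_space_bump (c : X) (U : set X) :
    compact [set: X] -> open U -> U c ->
  exists f : variation_space R X, [/\ continuous (val f), val f c = 1 &
    forall y, ~ U y -> val f y <= 0].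
Proof.
move=> cptX oU Uc.
have normalX : normal_space X := compact_normal circ_hausdorff cptX.
have cc : closed [set c] 
  by apply: (compact_closed circ_hausdorff); exact: compact_set1.
have dis : ~` U `&` [set c] = set0.
  by rewrite -subset0 => y [nU yc]; apply: nU; rewrite yc.
move/normal_separatorP : normalX => /(_ R _ _ (open_closedC oU) cc dis).
move=> /(@uniform_separatorP _ R)[u [cu u01 u0 u1]].
have {}u01 y : 0 <= u y <= 1 by have := u01 (u y) (ex_intro2 _ _ y I erefl).
have {}u1 : u c = 1 by apply: u1; exists c.
have cf := hull_continuous u01 cu u1.
have fV : hull c u \in @approximable_pred R X.
  apply/asboolP => e e0; exists (hull c u); split => //.
    exact: hull_chain_bounded.
  move=> x s _.
  have -> : (fun y => hull c u y - hull c u y) = (fun y => 0 * u y).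
    by apply/funext => y; rewrite subrr mul0r.
  by rewrite energyZ expr0n mul0r ltW.
exists (Sub (hull c u) fV : variation_space R X); split => //=.
  exact: hull_base.
move=> y nU; apply: le_trans (hull_le c u01 y) _.
by have -> : u y = 0 by apply: u0; exists y.
Qed.

End bump.
Arguments variation_space_bump R {X c U}.

(** * The isometric action *)

Section Hplus_action.
Context {X : circTopologicalType}.
Implicit Types (g h : Hplus X).

Lemma cutlt_Hplus {T : circType} (g : Hplus T) c a b :
  cutlt c a b -> cutlt (g c) (g a) (g b).
Proof.
have gI := bij_inj (Hplus_bij g).
case/cutltP => [[-> bc]|cab]; last exact/cord_cutlt/Hplus_cord.
by apply: cutlt_base => /gI.
Qed.

Lemma cyclic_chain_Hplus {T : circType} (g : Hplus T) x s :
  cyclic_chain x s -> cyclic_chain (g x) (map g s).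
Proof. by apply: homo_path => a b; exact: cutlt_Hplus. Qed.

(** A c-order preserving bijection maps arcs onto arcs. *)
Lemma Hplus_continuous g : continuous g.
Proof.
apply/continuousP => A; rewrite open_arcE => -[h|h]; first by left.
right=> x /h[a [b [ab gx sub]]].
exists (Hplus_inv g a), (Hplus_inv g b); split.
- by move=> e; apply: ab; rewrite -[a](Hplus_Kinv g) e Hplus_Kinv.
- by have := Hplus_cord (Hplus_inv g) gx; rewrite /oarc /= Hplus_invK.
- move=> y /(Hplus_cord g); rewrite !Hplus_Kinv; exact: sub.
Qed.

Context {R : realType}.
Local Notation V := (variation_space R X).

Lemma chain_bounded_comp (f : X -> R) g : chain_bounded f ->
  chain_bounded (fun x => f (g x)).
Proof.
move=> [M fM]; exists M => x s cs.
by rewrite chain_variation_comp; apply/fM/cyclic_chain_Hplus.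
Qed.

Fact approximable_comp (f : V) g :
  (fun x => val f (g x)) \in @approximable_pred R X.
Proof.
apply/asboolP => e e0; have [f0 [cf vf ef]] := variation_spaceP f e0.
exists (fun x => f0 (g x)); split; last 2 first.
- exact: chain_bounded_comp.
- move=> x s cs; rewrite (energy_comp (fun y => val f y - f0 y) g).
  exact/ef/cyclic_chain_Hplus.
- by move=> x; apply: continuous_comp; [exact: Hplus_continuous|exact: cf].
Qed.

Definition translate g (f : V) : V :=
  Sub (fun x => val f (g x)) (approximable_comp f g).

Lemma translateK g h (f : V) : cancel g h -> translate g (translate h f) = f.
Proof. by move=> gK; apply/val_inj/funext => x /=; rewrite gK. Qed.

Lemma translate_linear g : linear (translate g).
Proof. by move=> k f1 f2; apply/val_inj/funext. Qed.

Lemma translate_norm g (f : V) : `|translate g f| = `|f|.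
Proof.
have le h (u : V) : `|translate h u| <= `|u|.
  apply: variation_norm_le => // x s cs.
  by rewrite energy_comp; apply/energy_le_norm/cyclic_chain_Hplus.
apply/eqP; rewrite eq_le le /=.
have := le (Hplus_inv g) (translate g f).
by rewrite translateK//; exact: Hplus_Kinv.
Qed.

Lemma translate_onto g : set_surj setT setT (translate g).
Proof.
move=> f _; exists (translate (Hplus_inv g) f) => //.
by apply: translateK; exact: Hplus_invK.
Qed.

(** Composition with the inverse makes the action a left one. *)
Definition action g : linear_isometry V :=
  MkIsometry (translate_linear (Hplus_inv g)) (translate_norm (Hplus_inv g))
    (translate_onto (Hplus_inv g)).

Lemma actionM : {morph action : g h / (g * h)%g}.
Proof.
move=> g h; apply: isometry_eq => f; apply/val_inj/funext => x /=.
congr (val f _); apply: (bij_inj (Hplus_bij (g * h)%g)).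
by rewrite Hplus_Kinv /= !Hplus_Kinv.
Qed.

HB.instance Definition _ :=
  isMultiplicative.Build (Hplus X) (linear_isometry V) action actionM.

End Hplus_action.

(** * The topological embedding *)

Lemma eval_isometry_open {R : realType} {V : normedModType R} (f : V)
    (T0 : linear_isometry V) (r : R) : 0 < r ->
  exists2 B : set (linear_isometry V), open B &
    B T0 /\ forall T, B T -> `|T f - T0 f| < r.
Proof.
move=> r0.
exists [set T : linear_isometry V | `|T f - T0 f| < r]; last first.
  by rewrite /= subrr normr0.
exists [set t : {ptws V -> V} | `|t f - T0 f| < r] => //.
apply: (@open_comp _ _ (fun t : {ptws V -> V} => t f)
  [set v | `|v - T0 f| < r]).
  by move=> t _; exact: (@proj_continuous V (fun=> V) f).
have -> : [set v | `|v - T0 f| < r] = ball (T0 f) r.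
  by rewrite -ball_normE; apply/seteqP; split=> v /=; rewrite distrC.
exact: ball_open.
Qed.

Section representation.
Context {X : circTopologicalType} {R : realType}.
Hypothesis cptX : compact [set: X].
Local Notation V := (variation_space R X).

(** Compactness turns the compact-open neighbourhoods given by small compact
sets [K] around each point into a uniform estimate. *)
Lemma uniformly_near (f : X -> R) (g : Hplus X) (r : R) :
  continuous f -> 0 < r ->
  nbhs g [set h : Hplus X | forall x, `|f (h x) - f (g x)| <= r].
Proof.
move=> cf r0.
have cfg : continuous (fun x => f (g x)).
  by move=> x; apply: continuous_comp; [exact: Hplus_continuous|exact: cf].
suff : nbhs g [set h : Hplus X |
    [set: X] `<=` (fun x => `|f (h x) - f (g x)| <= r)].
  by apply: filterS => h hr x; exact: hr.
have /compact_near_coveringP cover := cptX.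
apply: (cover _ _ (fun (h : Hplus X) x => `|f (h x) - f (g x)| <= r)
  (nbhs_filter g)) => x _.
pose K := [set y | `|f (g y) - f (g x)| <= r / 4].
pose O := [set z | `|f z - f (g x)| < r / 2].
have cptK : compact K.
  apply: (subclosed_compact _ cptX) => //.
  apply: (@preimage_closed _ _ (fun y => `|f (g y) - f (g x)|)
    [set t | t <= r / 4]).
    by move=> y _; apply: cvg_norm; apply: cvgB; [exact: cfg|exact: cvg_cst].
  exact: closed_le.
have oO : open O.
  apply: (@open_comp _ _ (fun y => `|f y - f (g x)|) [set t | t < r / 2]).
    by move=> y _; apply: cvg_norm; apply: cvgB; [exact: cf|exact: cvg_cst].
  exact: open_lt.
have nK : nbhs x K.
  have /cvgrPdist_le/(_ (r / 4)) := cfg x; rewrite divr_gt0// => /(_ isT).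
  by apply: filterS => y; rewrite distrC.
have nO : nbhs g [set h : Hplus X | h @` K `<=` O].
  apply: open_nbhs_nbhs; split.
    exists [set h : {compact-open, X -> X} | h @` K `<=` O] => //.
    exact: compact_open_open.
  by move=> _ [y Ky <-]; apply: le_lt_trans Ky _; lra.
exists (K, [set h : Hplus X | h @` K `<=` O]) => //= -[y h] /= [Ky hO].
have := hO (h y) (ex_intro2 _ _ y Ky erefl); rewrite /O /= => hy.
have -> : f (h y) - f (g y) = (f (h y) - f (g x)) - (f (g y) - f (g x)) by ring.
apply: (le_trans (ler_normB _ _)); rewrite /K /= in Ky; lra.
Qed.

(** After composition with [h], an isometry, the difference of the two orbit
points becomes F o h - F o g with F the limit orbit point. With [f0] an
approximation of [F] of bounded variation, it is the sum of two small errors and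
of f0 o h - f0 o g, to which [energy_small] applies. *)
Lemma orbit_continuous (f : V) (g : Hplus X) :
  action h f @[h --> g] --> action g f.
Proof.
apply/(@cvgrPdist_le _ _ _ (nbhs g) (nbhs_filter g)) => e e0.
pose F := action g f.
have d0 : 0 < e ^+ 2 / 12 by rewrite divr_gt0 ?exprn_gt0.
have [f0 [cf /chain_bounded_sup[M M0 [f0M vM]] ef]] := variation_spaceP F d0.
have [r r0 rM] : exists2 r : R, 0 < r & r ^+ 2 + 2 * r * (2 * M) <= e ^+ 2 / 8.
  pose q := e ^+ 2 / (8 * (1 + 4 * M)).
  have M4 : 0 < 1 + 4 * M by rewrite ltr_pwDl// mulr_ge0.
  have q0 : 0 < q by rewrite divr_gt0 ?exprn_gt0 ?mulr_gt0.
  have qM : q * (1 + 4 * M) = e ^+ 2 / 8 by rewrite /q; field; rewrite gt_eqF.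
  exists (Num.min 1 q); first by rewrite lt_min ltr01.
  have tq : Num.min 1 q <= q by rewrite ge_min lexx orbT.
  have t1 : Num.min 1 q <= 1 by rewrite ge_min lexx.
  rewrite -qM.
  have : 0 < Num.min 1 q by rewrite lt_min ltr01.
  move: (Num.min 1 q) tq t1 => t tq t1 t0; nra.
apply: filterS (uniformly_near g cf r0) => h hr.
rewrite -/F -(translate_norm h); apply: variation_norm_le => [|x s cs].
  exact: ltW.
have -> : val (translate h (F - action h f)) =
   (fun y => (val F (h y) - f0 (h y)) +
     ((f0 (h y) - f0 (g y)) + -1 * (val F (g y) - f0 (g y)))).
  apply/funext => y.
  transitivity (val F (h y) - val f (Hplus_inv h (h y))) => //.
  by rewrite /F /= !Hplus_invK; ring.
have E1 (k : Hplus X) :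
    energy (fun y => val F (k y) - f0 (k y)) x s <= e ^+ 2 / 12.
  rewrite (energy_comp (fun y => val F y - f0 y) k).
  exact/ef/cyclic_chain_Hplus.
have E2 : energy (fun y => f0 (h y) - f0 (g y)) x s <= e ^+ 2 / 8.
  apply: le_trans rM; apply: energy_small => //; first exact: ltW.
  have -> : 2 * M = M + M by ring.
  have chain (k : Hplus X) := cyclic_chain_Hplus k cs.
  apply: le_trans (lerD (vM _ _ (chain h)) (vM _ _ (chain g))).
  rewrite -!chain_variation_comp -path_sumD; apply: le_path_sum => a b.
  have -> : f0 (h b) - f0 (g b) - (f0 (h a) - f0 (g a)) =
    (f0 (h b) - f0 (h a)) - (f0 (g b) - f0 (g a)) by ring.
  exact: ler_normB.
(* The budget: 2 / 12 + 2 * (2 / 8 + 2 / 12) = 1, in units of e^2. *)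
apply: (le_trans (energyD2 _ _ _ _)).
have := E1 h; have := E1 g.
have := energyD2 (fun y => f0 (h y) - f0 (g y))
  (fun y => -1 * (val F (g y) - f0 (g y))) x s.
rewrite (energyZ (-1) (fun y => val F (g y) - f0 (g y))); lra.
Qed.

Lemma action_continuous : continuous (action : Hplus X -> linear_isometry V).
Proof.
move=> g A; rewrite nbhsE => -[B [[C oC <-] Cg] BA].
have nC : nbhs (isometry_fun (action g) : {ptws V -> V}) C.
  exact: open_nbhs_nbhs.
pose act (h : Hplus X) := isometry_fun (action h : linear_isometry V).
have FF : Filter (act @ nbhs g) := fmap_filter _ (nbhs_filter g).
have [_ cvg] := pointwise_cvgP (act g) FF.
have : nbhs g [set h : Hplus X | C (isometry_fun (action h))].
  have oc f := @orbit_continuous f g.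
  exact: (cvg oc C nC).
by apply: filterS => h Ch; exact: BA.
Qed.

Lemma action_injective : injective (action : Hplus X -> linear_isometry V).
Proof.
move=> g h gh; apply: Hplus_eq => x; apply: contrapT => ghx.
have oU : open (~` [set h x]).
  apply/closed_openC/(compact_closed circ_hausdorff).
  exact: compact_set1.
have [f [_ f1 f0]] := variation_space_bump R cptX oU ghx.
have : action g (translate g f) = action h (translate g f) by rewrite gh.
move=> /(congr1 (fun u : V => val u (h x))) /=.
rewrite Hplus_Kinv Hplus_invK f1 => fx.
have : sval f (h x) <= 0 by apply: f0; exact.
by rewrite fx ler10.
Qed.

(** The filter [F g] of preimages of strong neighbourhoods converges to [g] in
the compact-open topology. At a point [x] of a compact set that [g] maps into an
open set [O], take a bump [f] at [g x], nonpositive off [O]; if the isometries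
of [h] and [g] agree up to 1/2 on f o g, then f o h and f o g differ by less
than 1/2, and so [h] maps the points where f o g > 1/2 into [O]. *)
Lemma action_open (A : set (Hplus X)) : open A ->
  exists2 B : set (linear_isometry V), open B &
    action @` A = B `&` range action.
Proof.
pose F (g : Hplus X) : set_system (Hplus X) :=
  [set A : set (Hplus X) | exists2 B : set (linear_isometry V),
    open B & B (action g) /\ action @^-1` B `<=` A].
have FF g : Filter (F g).
  split.
  - by exists setT; [exact: openT|split].
  - move=> P Q [B oB [Bg BP]] [C oC [Cg CQ]].
    exists (B `&` C); first exact: openI.
    by split => // h [/BP ? /CQ].
  - by move=> P Q PQ [B oB [Bg BP]]; exists B => //; split => // h /BP/PQ.
have Fcvg g : F g `=>` nbhs g.
  have [_ cvgF] := @compact_open_cvgP X X (fmap (@Hplus_fun X) (F g))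
    (Hplus_fun g) (fmap_filter _ (FF g)).
  have {cvgF} : fmap (@Hplus_fun X) (F g) `=>`
      nbhs (Hplus_fun g : {compact-open, X -> X}).
    apply: cvgF => K O cptK oO gKO.
    suff : F g [set h : Hplus X | K `<=` (fun x => O (h x))].
      apply: (@filterS _ _ (FF g)) => h hO _ [x Kx <-]; exact: hO.
    move/compact_near_coveringP : cptK => cover.
    apply: (cover _ _ (fun (h : Hplus X) x => O (h x)) (FF g)) => x Kx.
    have Ogx : O (g x) by apply: gKO; exists x.
    have [f [cf f1 f0]] := variation_space_bump R cptX oO Ogx.
    have h1 : 0 < 1 / 2 :> R by rewrite divr_gt0.
    have [B oB [Bg Bclose]] :=
      eval_isometry_open (translate g f) (action g) h1.
    have cfg : {for x, continuous (fun y => val f (g y))}.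
      by apply: continuous_comp; [exact: Hplus_continuous|exact: cf].
    have nx : nbhs x [set y | 1 / 2 < val f (g y)].
      move/cvgrPdist_lt : cfg => /(_ _ h1); apply: filterS => y.
      by rewrite /= f1 ltr_norml; lra.
    exists ([set y | 1 / 2 < val f (g y)], action @^-1` B) => /=.
      by split => //=; exists B => //; split.
    move=> [y h] /= [fy Bh]; apply: contrapT => /f0 fhy.
    have : `|val f (g (Hplus_inv h (h y))) -
        val f (g (Hplus_inv g (h y)))| < 1 / 2.
      exact: le_lt_trans (eval_le_norm _ (h y)) (Bclose _ Bh).
    rewrite Hplus_invK Hplus_Kinv ltr_norml => /andP[_].
    have {}fy : 1 / 2 < val f (g y) := fy.
    by move: (val f (g y)) (val f (h y)) fy fhy => u v; lra.
  move=> cvgF A'; rewrite nbhsE => -[_ [[C oC <-] Cg] CA'].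
  have /cvgF : nbhs (Hplus_fun g : {compact-open, X -> X}) C.
    exact: open_nbhs_nbhs.
  by apply: (@filterS _ _ (FF g)) => h; exact: CA'.
pose D := [set B : set (linear_isometry V) | open B /\ action @^-1` B `<=` A].
exists (\bigcup_(B in D) B); first by apply: bigcup_open => B [].
apply/seteqP; split => [_ [g Ag <-]|T [[B [oB BA] BT] [g _ gT]]].
  split; last by exists g.
  have [B oB [Bg BA]] : F g A by apply/Fcvg/open_nbhs_nbhs.
  by exists B.
by rewrite -gT in BT *; exists g => //; exact: BA.
Qed.

End representation.

(** * The circle *)

Section circle_compact.
Context {R : realType}.
Local Notation C := (circ_topology (circle R)).

Let val_circle (x : C) : R := val (x : circle R).

Lemma cord_circleE (a b c : C) : cord a b c <->
  [\/ val_circle a < val_circle b < val_circle c,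
      val_circle b < val_circle c < val_circle a |
      val_circle c < val_circle a < val_circle b].
Proof. exact: circle_cordP. Qed.

Lemma circle_three (a b c : C) : val_circle a < val_circle b ->
  val_circle b < val_circle c -> ~ [\/ a = b, b = c | a = c].
Proof. by move=> ab bc [] e; move: ab bc; rewrite e; lra. Qed.

(** Neighbourhoods of the base point 0 of the circle contain the points close to
0 and those close to 1, hence the two ends of the segment [0, 1] map to it. *)
Lemma nbhs_circle (t : R) (x : C) (B : set C) :
    0 <= t <= 1 -> val_circle x = (if t < 1 then t else 0) ->
    open B -> B x ->
  exists2 W, nbhs t W & forall y : C, W (val_circle y) -> B y.
Proof.
move=> t01 xt; rewrite arc_openE => -[two _|]; last first.
  move=> /[apply] -[a [b [_ /cord_circleE axb abB]]].
  have ra : 0 <= val_circle a < 1 := valP (a : circle R).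
  have rb : 0 <= val_circle b < 1 := valP (b : circle R).
  have in_arc y : cord a y b -> B y by move=> /abB.
  have lt_nbhs p : p < t -> nbhs t [set s | p < s].
    by move=> pt; apply: open_nbhs_nbhs; split; [exact: open_gt|].
  have gt_nbhs p : t < p -> nbhs t [set s | s < p].
    by move=> pt; apply: open_nbhs_nbhs; split; [exact: open_lt|].
  move: axb; rewrite xt; case: (ltP t 1) => t1 [] /andP[h1 h2].
  - exists ([set s | val_circle a < s] `&` [set s | s < val_circle b]).
      by apply: filterI; [exact: lt_nbhs|exact: gt_nbhs].
    move=> y [/= ay yb]; apply/in_arc/cord_circleE/Or31; lra.
  - exists [set s | s < val_circle b]; first exact: gt_nbhs.
    by move=> y /= yb; apply/in_arc/cord_circleE/Or32; lra.
  - exists [set s | val_circle a < s]; first exact: lt_nbhs.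
    by move=> y /= yb; apply/in_arc/cord_circleE/Or33; lra.
  - lra.
  - exists [set s | val_circle a < s]; first by apply: lt_nbhs; lra.
    by move=> y /= yb; apply/in_arc/cord_circleE/Or33; lra.
  - lra.
have pt (p : R) : 0 <= p < 1 -> exists y : C, val_circle y = p.
  by move=> p01; exists (Sub p p01 : circle R).
have [a a0] := pt 0 ltac:(lra); have [b b1] := pt (1 / 3) ltac:(lra).
have [c c2] := pt (2 / 3) ltac:(lra).
have ab : val_circle a < val_circle b by lra.
have bc : val_circle b < val_circle c by lra.
by case: (circle_three ab bc (two a b c)).
Qed.

Lemma circle_compact : compact [set: C].
Proof.
move=> F FF _.
have segF : (val_circle @ F) [set` `[0, 1]].
  apply: (@filterS _ F _ setT) => [x _ /=|]; last exact: filterT.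
  have : 0 <= val_circle x < 1 := valP (x : circle R).
  by rewrite /= in_itv /=; lra.
have [t [+ Ft]] := @segment_compact R 0 1 (val_circle @ F) _ segF.
rewrite /= in_itv /= => t01.
pose w : R := if t < 1 then t else 0.
have wP : 0 <= w < 1 by rewrite /w; case: ltP; lra.
pose x : C := (Sub w wP : circle R).
exists x; split => // A B FA; rewrite nbhsE => -[B' [oB' B'x] BB].
have [W tW WB] := nbhs_circle t01 (erefl : val_circle x = _) oB' B'x.
have FvA : (val_circle @ F) (val_circle @` A).
  exact: filterS (@preimage_image _ _ val_circle A) FA.
have [_ [[y Ay <-] Wy]] := Ft _ _ FvA tW.
by exists y; split => //; apply/BB/WB.
Qed.

End circle_compact.

(** * The representation theorem *)

Lemma Hplus_rosenthal_representable (R : realType) (X : circTopologicalType) :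
  compact [set: X] -> rosenthal_representable R (Hplus X).
Proof.
move=> cptX; exists (variation_space R X).
  exact: variation_space_rosenthal.
exists action; split.
- exact: action_injective.
- exact: action_continuous.
- exact: action_open.
Qed.

Theorem theorem4p6 (R : realType) :
  (forall X : circTopologicalType, compact [set: X] ->
     rosenthal_representable R (Hplus X)) /\
  rosenthal_representable R (Hplus (circ_topology (circle R))).
Proof.
split; first by move=> X; exact: Hplus_rosenthal_representable.
by apply: Hplus_rosenthal_representable; exact: circle_compact.
Qed.
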